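(* Let $\mathcal G$ be a $\Gamma$-periodic graph in $\mathbb R^d$ with fixed (possibly equal) vertices $v_1,v_2\in\mathcal V\cap\Omega$, and let $Q$ be a real periodic potential given by a vector $(Q_v)_{v\in\mathcal V_*}\in\mathbb R^\nu$, $\nu=\#\mathcal V_*$. Let $j\in\{1,\ldots,\nu\}$, and fix a sign: ''$-$'' (minimum, lower band edge) or ''$+$'' (maximum, upper band edge). Assume that the band function $\widetilde\lambda_j(\cdot)$ of $H_{\widetilde{\mathcal G}}=\Delta_{\widetilde{\mathcal G}}+Q$ on the limit graph $\widetilde{\mathcal G}$ satisfies: (A1) $\widetilde\lambda_j(\cdot)$ has a non-degenerate minimum $\widetilde\lambda_j^-$ (for sign $-$), respectively a non-degenerate maximum $\widetilde\lambda_j^+$ (for sign $+$), at some point $k_o\in\mathbb T^{d+1}$, and this extremum $\widetilde\lambda_j^\pm$ is attained by the single band function $\widetilde\lambda_j(\cdot)$ (i.e. no other band function $\widetilde\lambda_i(\cdot)$, $i\ne j$, takes the value $\widetilde\lambda_j^\pm$); (A2) $k_o$ is the only (up to evenness, i.e. up to replacing $k_o$ by $-k_o$ modulo $2\pi\mathbb Z^{d+1}$) minimum point, respectively maximum point, of $\widetilde\lambda_j(\cdot)$ in $\mathbb T^{d+1}$. Then the band edge $\lambda_j^\pm(t)$, $t=(t_1,\ldots,t_d)\in\mathbb Z^d$, of $H_{\mathcal G_t}=\Delta_{\mathcal G_t}+Q$ on the perturbed graph $\mathcal G_t$ corresponding to the chosen sign satisfies $$\lambda_j^\pm(t)=\widetilde\lambda_j^\pm\mp\frac{2\pi^2\alpha^2(\varrho_t(k_o))}{|\mathbf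 H^{-1/2}\mathfrak t|^2}+g(t),\qquad g(t)=O\Big(\frac1{|t|^3}\Big)\quad\text{as } |t|\to\infty,$$ where $\mathbf H=\mp\operatorname{Hess}\widetilde\lambda_j(k_o)$ and $\mathfrak t=(t_1,\ldots,t_d,-1)$. Moreover, if all components of $k_o$ are equal to either $0$ or $\pi$, then $g(t)=O\big(\frac1{|t|^4}\big)$ as $|t|\to\infty$.
   Context: **Periodic graphs.** Let $\Gamma$ be a lattice of rank $d$ in $\mathbb R^d$ with basis $\mathfrak a_1,\ldots,\mathfrak a_d$ and fundamental cell $\Omega=\{\sum_{s=1}^d x_s\mathfrak a_s: x_s\in[0,1)\}$. A $\Gamma$-periodic graph $\mathcal G=(\mathcal V,\mathcal E)$ is a connected infinite locally finite graph embedded in $\mathbb R^d$ (loops and multiple edges allowed) that is invariant under translation by every vector of $\Gamma$ and whose quotient $\mathcal G_*=\mathcal G/\Gamma=(\mathcal V_*,\mathcal E_* )$ (the fundamental graph) is finite. Vertices of $\mathcal G_*$ are identified with the vertices in $\mathcal V\cap\Omega$. Each unoriented edge (also each loop) gives two oriented edges $\mathbf e$ and $\overline{\mathbf e}$ (mutually inverse); $\mathcal A$ and $\mathcal A_*=\mathcal A/\Gamma$ are the sets of oriented edges of $\mathcal G$ and $\mathcal G_*$. **Edge indices.** Every $v\in\mathcal V$ is uniquely $v=v_0+[v]$ with $v_0\in\mathcal V\cap\Omega$, $[v]\in\Gamma$. The index of an oriented edge $\mathbf e=(u,v)\in\mathcal A$ is the vector $\tau(\mathbf e)\in\mathbb Z^d$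 of coordinates of $[v]-[u]$ in the basis $\mathfrak a_1,\ldots,\mathfrak a_d$. It is $\Gamma$-invariant, so it defines $\tau(\mathbf e)$ for $\mathbf e\in\mathcal A_*$; moreover $\tau(\overline{\mathbf e})=-\tau(\mathbf e)$. **Schrödinger operators and band edges.** For a $\Gamma$-periodic potential $Q:\mathcal V\to\mathbb R$ (determined by $(Q_v)_{v\in\mathcal V_*}$), $H=\Delta+Q$ acts on $\ell^2(\mathcal V)$ by $(\Delta f)_v=\sum_{(v,u)\in\mathcal A}(f_v-f_u)$, $(Qf)_v=Q_vf_v$. With $\mathbb T^d=(-\pi,\pi]^d=\mathbb R^d/2\pi\mathbb Z^d$, the fiber operators on $\ell^2(\mathcal V_* )=\mathbb C^\nu$, $\nu=\#\mathcal V_*$, are $H(k)=\Delta(k)+Q$, $(\Delta(k)f)_v=\sum_{\mathbf e=(v,u)\in\mathcal A_*}(f_v-e^{i\langle\tau(\mathbf e),k\rangle}f_u)$. The eigenvalues $\lambda_1(k)\le\ldots\le\lambda_\nu(k)$ of $H(k)$, counted with multiplicity, are the band functions (they are even: $\lambda_j(-k)=\lambda_j(k)$); the band edges are $\lambda_j^-=\min_{k\in\mathbb T^d}\lambda_j(k)$, $\lambda_j^+=\max_{k\in\mathbb T^d}\lambda_j(k)$, and $\sigma(H)=\bigcup_{j=1}^\nu[\lambda_j^-,\lambda_j^+]$. The same definitions apply to periodic graphs in any dimension. **Perturbed graph.** For $t=(t_1,\ldots,t_d)\in\mathbb Z^d$, $\mathcal G_t$ is the $\Gamma$-periodic graph obtained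 from $\mathcal G$ (same vertex set) by adding the edges $\mathbf e_o+\mathfrak a$, $\mathfrak a\in\Gamma$, where $\mathbf e_o=(v_1,v_2+t_1\mathfrak a_1+\ldots+t_d\mathfrak a_d)$. Its fundamental graph is $(\mathcal V_*,\mathcal E_*\cup\{\mathbf e_o\})$, the added edge $\mathbf e_o=(v_1,v_2)$ having index $t$. Its band edges are denoted $\lambda_j^\pm(t)$. **Limit graph.** Complete $\mathfrak a_1,\ldots,\mathfrak a_d$ (with $\mathbb R^d$ viewed as $\mathbb R^d\times\{0\}\subset\mathbb R^{d+1}$) by a vector $\mathfrak a_{d+1}$ to a basis of $\mathbb R^{d+1}$, and let $\widetilde\Gamma$ be the lattice with basis $\mathfrak a_1,\ldots,\mathfrak a_{d+1}$. The limit graph $\widetilde{\mathcal G}$ is the $\widetilde\Gamma$-periodic graph consisting of the copies $\mathcal G+n\mathfrak a_{d+1}$, $n\in\mathbb Z$, together with the edges $\mathbf e_o+\mathfrak a$, $\mathfrak a\in\widetilde\Gamma$, where $\mathbf e_o=(v_1,v_2+\mathfrak a_{d+1})$. Its fundamental graph is also $(\mathcal V_*,\mathcal E_*\cup\{\mathbf e_o\})$; with respect to $\widetilde\Gamma$, the edges of $\mathcal A_*$ have indices $(\tau(\mathbf e),0)\in\mathbb Z^{d+1}$ and $\mathbf e_o$ has index $(0,\ldots,0,1)$. The potential on $\widetilde{\mathcal G}$ is the $\widetilde\Gamma$-periodic potential given by the same vector $(Q_v)_{v\in\mathcal V_*}$. The band functions of $H_{\widetilde{\mathcal G}}$ on $\mathbb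 T^{d+1}$ are denoted $\widetilde\lambda_j(\cdot)$, and its band edges $\widetilde\lambda_j^\pm$. **Further notation.** $\varrho_t(k)=\frac1{2\pi}(t_1k_1+\ldots+t_dk_d-k_{d+1})$ for $k=(k_1,\ldots,k_{d+1})\in\mathbb T^{d+1}=(-\pi,\pi]^{d+1}$. For $x\in\mathbb R$, $\alpha(x)=x-\mathrm n(x)\in(-\frac12,\frac12]$, where $\mathrm n(x)$ is the integer closest to $x$. $\operatorname{Hess}$ is the Hessian matrix; a minimum (maximum) point is non-degenerate if the Hessian there is positive (negative) definite; $\mathbf H^{-1/2}$ is the inverse of the positive definite square root of the positive definite matrix $\mathbf H$. $|\cdot|$ is the Euclidean norm. Upper signs in $\pm,\mp$ correspond to $\lambda_j^+(t)$, lower signs to $\lambda_j^-(t)$. *)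

(* Defs.v *)
From HB Require Import structures.
From mathcomp Require Import all_boot all_order all_algebra.
From mathcomp Require Import finmap.
From mathcomp Require Import all_classical all_reals all_analysis.
From mathcomp Require Import complex.

Set Implicit Arguments.
Unset Strict Implicit.
Unset Printing Implicit Defensive.

Import Order.TTheory GRing.Theory Num.Theory.
Import numFieldNormedType.Exports.
Local Open Scope classical_set_scope.
Local Open Scope ring_scope.

(* A graph in R^d with translations by a lattice.  The lattice is the integer
   row span of [basis].  Vertices are points of R^d (through [pos]); edges are
   abstract oriented edges, so that loops and multiple edges are possible, and
   each unoriented edge is a pair {e, inv e}.  [vshift m] and [eshift m] are the
   translations of vertices and edges by the lattice vector of coordinates m. *)
Record lattice_graph (R : realType) (d : nat) := LatticeGraph {
  basis : 'M[R]_d;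
  vertex : choiceType;
  edge : choiceType;
  pos : vertex -> 'rV[R]_d;
  src : edge -> vertex;
  tgt : edge -> vertex;
  inv : edge -> edge;
  vshift : 'rV[int]_d -> vertex -> vertex;
  eshift : 'rV[int]_d -> edge -> edge
}.

Definition toR (R : realType) (n : nat) (t : 'rV[int]_n) : 'rV[R]_n :=
  map_mx intr t.

Definition dotp (R : realType) (n : nat) (x y : 'rV[R]_n) : R :=
  \sum_(i < n) x 0 i * y 0 i.

(* The norm [`|x|] of the library on row vectors is the sup norm. *)
Definition enorm (R : realType) (n : nat) (x : 'rV[R]_n) : R :=
  Num.sqrt (dotp x x).

Section Graph.
Variables (R : realType) (d : nat) (G : lattice_graph R d).

Definition fundamental_cell : set 'rV[R]_d :=
  [set x | exists2 c : 'rV[R]_d,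
     (forall s, 0 <= c 0 s < 1) & x = c *m basis G].

Definition cell_vertices : set (vertex G) :=
  [set v | fundamental_cell (pos v)].

Fixpoint walk (u : vertex G) (p : seq (edge G)) (v : vertex G) : Prop :=
  if p is e :: q then src e = u /\ walk (tgt e) q v else u = v.

Definition connected_graph : Prop := forall u v, exists p, walk u p v.

Definition edge_orbit (e : edge G) : set (edge G) :=
  range (fun m => eshift m e).

Record invariant_graph : Prop := InvariantGraph {
  basis_unit : basis G \in unitmx;
  pos_inj : injective (@pos R d G);
  pos_vshift : forall m (v : vertex G),
    pos (vshift m v) = pos v + toR R m *m basis G;
  invK : forall e : edge G, inv (inv e) = e;
  inv_neq : forall e : edge G, inv e <> e;
  src_inv : forall e : edge G, src (inv e) = tgt e;
  eshift0 : forall e : edge G, eshift 0 e = e;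
  eshiftD : forall m n (e : edge G), eshift (m + n) e = eshift m (eshift n e);
  src_eshift : forall m (e : edge G), src (eshift m e) = vshift m (src e);
  inv_eshift : forall m (e : edge G), inv (eshift m e) = eshift m (inv e);
  locally_finite : forall v : vertex G, finite_set [set e | src e = v];
  finite_vertices : finite_set cell_vertices;
  finite_edges : finite_set (range edge_orbit)
}.

Definition periodic_graph : Prop :=
  [/\ invariant_graph, connected_graph & infinite_set [set: vertex G] ].

Definition periodic_potential (Q : vertex G -> R) : Prop :=
  forall m v, Q (vshift m v) = Q v.

(* v = cell_part v + [v], with [lattice_part v] the integer coordinates of [v]. *)
Definition lattice_part (v : vertex G) : 'rV[int]_d :=
  map_mx Num.floor (pos v *m invmx (basis G)).

Definition cell_part (v : vertex G) : vertex G := vshift (- lattice_part v) v.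

Definition edge_index (e : edge G) : 'rV[int]_d :=
  lattice_part (tgt e) - lattice_part (src e).

Definition nu : nat := #|{: fset_set cell_vertices}|.

Definition cell_vertex (x : 'I_nu) : vertex G :=
  fsval (enum_val x).

Definition expi (x : R) : R[i] := (cos x +i* sin x)%C.

(* The oriented edges of the fundamental graph starting at a vertex v of the
   fundamental cell are represented by the edges of G with source v: each orbit
   of edges with source in v + lattice contains exactly one of them. *)
Definition fiber_laplacian (k : 'rV[R]_d) : 'M[R[i]]_nu :=
  \matrix_(x, y)
    \sum_(e \in [set e : edge G | src e = cell_vertex x])
      ((cell_vertex x == cell_vertex y)%:R
       - expi (dotp (toR R (edge_index e)) k)
         * (cell_part (tgt e) == cell_vertex y)%:R).

Definition fiber_schrodinger (Q : vertex G -> R) (k : 'rV[R]_d) :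
    'M[R[i]]_nu :=
  fiber_laplacian k + diag_mx (\row_x (Q (cell_vertex x))%:C%C).

End Graph.

(* For a Hermitian matrix, the eigenvalues counted with multiplicity, in
   nondecreasing order: they are the roots of the characteristic polynomial, and
   they are real. *)
Definition sorted_eigenvalues (R : realType) (n : nat) (M : 'M[R[i]]_n) :
    seq R :=
  sort <=%R (map (@complex.Re R) (sval (closed_field_poly_normal (char_poly M)))).

Definition torus (R : realType) (n : nat) : set 'rV[R]_n :=
  [set k | forall i, - pi < k 0 i <= pi].

(* The indices of the band functions start at 0. *)
Definition band (R : realType) (d : nat) (G : lattice_graph R d)
    (Q : vertex G -> R) (j : nat) (k : 'rV[R]_d) : R :=
  nth 0 (sorted_eigenvalues (fiber_schrodinger Q k)) j.

Inductive edge_side := Lower | Upper.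

Definition side_sign (R : realType) (s : edge_side) : R :=
  if s is Upper then 1 else -1.

(* The infimum and supremum are attained: the band functions are continuous and
   (2 pi Z)^d-periodic. *)
Definition band_edge (R : realType) (d : nat) (G : lattice_graph R d)
    (Q : vertex G -> R) (s : edge_side) (j : nat) : R :=
  if s is Upper then sup [set band Q j k | k in @torus R d]
  else inf [set band Q j k | k in @torus R d].

Definition extremum_point (R : realType) (n : nat) (s : edge_side)
    (f : 'rV[R]_n -> R) (k : 'rV[R]_n) : Prop :=
  torus k /\
  forall k', torus k' -> if s is Upper then f k' <= f k else f k <= f k'.

(* The edges (inr (m, false)) and (inr (m, true)) are the translate by m of the
   new edge (u, v) and its inverse. *)
Definition add_edges (R : realType) (d : nat) (G : lattice_graph R d)
    (u v : vertex G) : lattice_graph R d :=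
  @LatticeGraph R d (basis G) (vertex G)
    (edge G + 'rV[int]_d * bool)%type
    (@pos R d G)
    (fun e => match e with
              | inl e => src e
              | inr (m, b) => vshift m (if b then v else u) end)
    (fun e => match e with
              | inl e => tgt e
              | inr (m, b) => vshift m (if b then u else v) end)
    (fun e => match e with
              | inl e => inl (inv e)
              | inr (m, b) => inr (m, ~~ b) end)
    (@vshift R d G)
    (fun n e => match e with
              | inl e => inl (eshift n e)
              | inr (m, b) => inr (n + m, b) end).

Definition perturbed_graph (R : realType) (d : nat) (G : lattice_graph R d)
    (v1 v2 : vertex G) (t : 'rV[int]_d) : lattice_graph R d :=
  add_edges v1 (vshift t v2).

Definition limit_basis (R : realType) (d : nat) (G : lattice_graph R d)
    (a : 'rV[R]_(d + 1)) : 'M[R]_(d + 1) :=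
  col_mx (row_mx (basis G) 0) a.

(* The union of the copies G + n a, n in Z: the pair (v, n) is v + n a. *)
Definition stack (R : realType) (d : nat) (G : lattice_graph R d)
    (a : 'rV[R]_(d + 1)) : lattice_graph R (d + 1) :=
  @LatticeGraph R (d + 1) (limit_basis G a)
    (vertex G * int)%type (edge G * int)%type
    (fun v => row_mx (pos v.1) 0 + v.2%:~R *: a)
    (fun e => (src e.1, e.2))
    (fun e => (tgt e.1, e.2))
    (fun e => (inv e.1, e.2))
    (fun m v => (vshift (lsubmx m) v.1, rsubmx m 0 0 + v.2))
    (fun m e => (eshift (lsubmx m) e.1, rsubmx m 0 0 + e.2)).

Definition limit_graph (R : realType) (d : nat) (G : lattice_graph R d)
    (v1 v2 : vertex G) (a : 'rV[R]_(d + 1)) : lattice_graph R (d + 1) :=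
  @add_edges R (d + 1) (stack G a) (v1, 0) (v2, 1).

Definition limit_potential (R : realType) (d : nat) (G : lattice_graph R d)
    (v1 v2 : vertex G) (a : 'rV[R]_(d + 1)) (Q : vertex G -> R) :
    vertex (limit_graph v1 v2 a) -> R :=
  fun v => Q v.1.

Definition Hess (R : realType) (n : nat) (f : 'rV[R]_n -> R) (x : 'rV[R]_n) :
    'M[R]_n :=
  \matrix_(i, j) 'D_(delta_mx 0 i) (fun y => 'D_(delta_mx 0 j) f y) x.

Definition posdef (R : realType) (n : nat) (M : 'M[R]_n) : Prop :=
  M^T = M /\ forall x : 'rV[R]_n, x != 0 -> 0 < (x *m M *m x^T) 0 0.

Definition possqrt (R : realType) (n : nat) (M : 'M[R]_n) : 'M[R]_n :=
  xget 0 [set S : 'M[R]_n | posdef S /\ S *m S = M].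

(* Ties in the closest integer n(x) go down, so that alpha x = 1/2 there. *)
Definition alpha (R : realType) (x : R) : R := x - (Num.ceil (x - 2^-1))%:~R.

Definition rho (R : realType) (d : nat) (t : 'rV[int]_d)
    (k : 'rV[R]_(d + 1)) : R :=
  (2 * pi)^-1 * (dotp (toR R t) (lsubmx k) - rsubmx k 0 0).

(* g(t) = O(1 / |t|^p) as |t| tends to infinity in Z^d. *)
Definition bigO_inv_power (R : realType) (d : nat) (p : nat)
    (g : 'rV[int]_d -> R) : Prop :=
  exists C M : R, forall t : 'rV[int]_d,
    M <= enorm (toR R t) -> `|g t| <= C / enorm (toR R t) ^+ p.

Lemma vshift0 (R : realType) (d : nat) (G : lattice_graph R d) :
  invariant_graph G -> forall v : vertex G, vshift 0 v = v.
Proof.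
move=> hG v; apply: (pos_inj hG); rewrite (pos_vshift hG).
by rewrite /toR map_mx0 mul0mx addr0.
Qed.

Lemma vshiftD (R : realType) (d : nat) (G : lattice_graph R d) :
  invariant_graph G ->
  forall m n (v : vertex G), vshift (m + n) v = vshift m (vshift n v).
Proof.
move=> hG m n v; apply: (pos_inj hG); rewrite !(pos_vshift hG).
by rewrite /toR map_mxD mulmxDl -addrA [X in _ + X]addrC.
Qed.

Lemma vshift_inj (R : realType) (d : nat) (G : lattice_graph R d) :
  invariant_graph G ->
  forall m n (v : vertex G), vshift m v = vshift n v -> m = n.
Proof.
move=> hG m n v /(congr1 (@pos _ _ G)); rewrite !(pos_vshift hG) => /addrI.
move=> /(congr1 (mulmxr (invmx (basis G)))) /=.
rewrite !mulmxK ?(basis_unit hG) // => /matrixP e; apply/matrixP => i j.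
by have := e i j; rewrite !mxE => /intr_inj.
Qed.

Lemma add_edges_invariant (R : realType) (d : nat) (G : lattice_graph R d)
  (u v : vertex G) : invariant_graph G -> invariant_graph (add_edges u v).
Proof.
move=> hG; have fin1 w x : finite_set [set m | @vshift _ _ G m w = x].
  have [[m0 h0]|h0] := pselect (exists m, @vshift _ _ G m w = x).
    apply: (@sub_finite_set _ _ [set m0]); last exact: finite_set1.
    by move=> m /= hm; apply: (vshift_inj hG (v := w)); rewrite hm h0.
  apply: (@sub_finite_set _ _ set0); last exact: finite_set0.
  by move=> m hm; case: h0; exists m.
split.
- exact: basis_unit hG.
- exact: pos_inj hG.
- exact: pos_vshift hG.
- by move=> [e|[m b]] /=; rewrite ?(invK hG) ?negbK.
- by move=> [e|[m []]] //= [] /(inv_neq hG).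
- by move=> [e|[m []]] //=; rewrite (src_inv hG).
- by move=> [e|[m b]] /=; rewrite ?(eshift0 hG) ?add0r.
- by move=> m n [e|[p b]] /=; rewrite ?(eshiftD hG) ?addrA.
- by move=> m [e|[p b]] /=; rewrite ?(src_eshift hG) ?(vshiftD hG).
- by move=> m [e|[p b]] /=; rewrite ?(inv_eshift hG).
- move=> x; apply: (@sub_finite_set _ _
    (inl @` [set e : edge G | src e = x] `|`
     ((fun m => inr (m, true)) @` [set m | @vshift _ _ G m v = x] `|`
      (fun m => inr (m, false)) @` [set m | @vshift _ _ G m u = x]))).
    move=> [e|[m []]] /= h; first by left; exists e.
      by right; left; exists m.
    by right; right; exists m.
  rewrite !finite_setU; split; last split; apply: finite_image => //.
  exact: locally_finite hG x.
- exact: finite_vertices hG.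
- apply: (@sub_finite_set _ _
    ((fun O => inl @` O) @` range (@edge_orbit _ _ G) `|`
     ((fun b => range (fun m => inr (m, b))) @` [set: bool]))).
    move=> _ [[e|[m b]] _ <-].
      left; exists (edge_orbit e); first by exists e.
      apply/seteqP; split=> [_ [_ [m _ <-] <-]|_ [m _ <-]] /=.
        by exists m.
      by exists (eshift m e) => //; exists m.
    right; exists b => //; apply/seteqP; split=> [_ [n _ <-]|_ [n _ <-]] /=.
      by exists (n - m) => //=; rewrite subrK.
    by exists (n + m).
  rewrite finite_setU; split; apply: finite_image; first exact: finite_edges hG.
  exact: finite_finset.
Qed.

Lemma walk_cat (R : realType) (d : nat) (G : lattice_graph R d)
  (u v w : vertex G) p q : walk u p v -> walk v q w -> walk u (p ++ q) w.
Proof. by elim: p u => [|e p IH] u /= => [->|[-> /IH]] // h /h. Qed.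

Lemma walk_add_edges (R : realType) (d : nat) (G : lattice_graph R d)
  (u v x y : vertex G) p :
  walk x p y -> @walk _ _ (add_edges u v) x (map inl p) y.
Proof. by elim: p x => [|e p IH] x //= [-> /IH]. Qed.

Lemma perturbed_periodic (R : realType) (d : nat) (G : lattice_graph R d)
  (v1 v2 : vertex G) t :
  periodic_graph G -> periodic_graph (perturbed_graph v1 v2 t).
Proof.
move=> [hG cG iG]; split; first exact: add_edges_invariant.
  by move=> x y; have [p hp] := cG x y; exists (map inl p); apply: walk_add_edges.
exact: iG.
Qed.

Lemma stack_pos (R : realType) (d : nat) (G : lattice_graph R d)
  (a : 'rV[R]_(d + 1)) (v : vertex (stack G a)) : invariant_graph G ->
  pos v = row_mx (pos v.1 *m invmx (basis G)) (v.2%:~R)%:M *m limit_basis G a.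
Proof.
move=> hG; rewrite /limit_basis mul_row_col mul_mx_row mulmx0.
by rewrite mulmxKV ?(basis_unit hG) // mul_scalar_mx.
Qed.

Lemma stack_invariant (R : realType) (d : nat) (G : lattice_graph R d)
  (a : 'rV[R]_(d + 1)) : limit_basis G a \in unitmx ->
  invariant_graph G -> invariant_graph (stack G a).
Proof.
move=> ha hG; split.
- exact: ha.
- move=> x y; rewrite !stack_pos // => /(congr1 (mulmxr (invmx (limit_basis G a)))).
  rewrite /= !mulmxK // => /eq_row_mx[h1 h2].
  case: x y h1 h2 => [x m] [y n] /= h1 h2; congr pair.
    apply: (pos_inj hG); move: h1 => /(congr1 (mulmxr (basis G))) /=.
    by rewrite !mulmxKV ?(basis_unit hG).
  by have /matrixP/(_ 0 0) := h2; rewrite !mxE eqxx !mulr1n => /intr_inj.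
- move=> m [x n] /=; rewrite (pos_vshift hG) /limit_basis.
  have -> : toR R m = row_mx (toR R (lsubmx m)) (toR R (rsubmx m)).
    by rewrite -map_row_mx hsubmxK.
  rewrite mul_row_col mul_mx_row mulmx0.
  have -> : toR R (rsubmx m) = ((rsubmx m 0 0)%:~R)%:M.
    by apply/matrixP => i k; rewrite !ord1 !mxE eqxx mulr1n.
  rewrite mul_scalar_mx intrD scalerDl.
  rewrite -[X in row_mx (_ + _) X]addr0 -add_row_mx -addrA -[RHS]addrA.
  by rewrite [n%:~R *: a + (_ + _)]addrCA [n%:~R *: a + _]addrC.
- by move=> [e n] /=; rewrite (invK hG).
- by move=> [e n] [] /(inv_neq hG).
- by move=> [e n] /=; rewrite (src_inv hG).
- by move=> [e n] /=; rewrite linear0 (eshift0 hG) linear0 mxE add0r.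
- by move=> m p [e n] /=; rewrite !linearD (eshiftD hG) mxE addrA.
- by move=> m [e n] /=; rewrite (src_eshift hG).
- by move=> m [e n] /=; rewrite (inv_eshift hG).
- move=> [x n]; apply: (@sub_finite_set _ _
    ((fun e => (e, n)) @` [set e : edge G | src e = x])).
    by move=> [e k] [he hk] /=; exists e => //; congr pair.
  by apply: finite_image; exact: locally_finite hG x.
- apply: (@sub_finite_set _ _ ((fun v => (v, 0)) @` @cell_vertices _ _ G)).
    move=> x [c c01]; rewrite stack_pos // -[c in RHS]hsubmxK.
    move=> /(congr1 (mulmxr (invmx (limit_basis G a)))) /=.
    rewrite !mulmxK // => /eq_row_mx[h1 h2].
    have x20 : x.2 = 0.
      have /matrixP/(_ 0 0) := h2; rewrite !mxE eqxx mulr1n => h.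
      have := c01 (rshift d 0); rewrite -h ler0z ltrz1.
      by case: (x.2) => [[|n]|n].
    exists x.1; last by case: x x20 {h1 h2} => [? ?] /= ->.
    exists (lsubmx c); first by move=> i; rewrite mxE.
    by rewrite -h1 mulmxKV ?(basis_unit hG).
  by apply: finite_image; exact: finite_vertices hG.
- apply: (@sub_finite_set _ _
    ((fun O => O `*` [set: int]) @` range (@edge_orbit _ _ G))).
    move=> _ [[e n] _ <-]; exists (edge_orbit e); first by exists e.
    apply/seteqP; split=> [[f k] [[m _ /= <-] _]|_ [m _ <-]] /=.
      exists (row_mx m (k - n)%:M) => //=.
      by rewrite row_mxKl row_mxKr mxE eqxx mulr1n subrK.
    by split=> //; exists (lsubmx m).
  by apply: finite_image; exact: finite_edges hG.
Qed.

Lemma limit_periodic (R : realType) (d : nat) (G : lattice_graph R d)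
  (v1 v2 : vertex G) (a : 'rV[R]_(d + 1)) : limit_basis G a \in unitmx ->
  periodic_graph G -> periodic_graph (limit_graph v1 v2 a).
Proof.
move=> ha [hG cG iG]; split.
- by apply: add_edges_invariant; exact: stack_invariant.
- pose L : lattice_graph R (d + 1) := limit_graph v1 v2 a.
  have inlayer (x y : vertex G) (n : int) :
      exists p, @walk _ _ L (x, n) p (y, n).
    have [p hp] := cG x y; exists (map inl (map (fun e => (e, n)) p)).
    apply: walk_add_edges; elim: p x hp => [|e p IH] x /=; first by move=> ->.
    by move=> [<- /IH].
  have shl n : @lsubmx _ 1 d 1 (row_mx 0 (n%:M : 'M[int]_1)) = 0 by rewrite row_mxKl.
  have shr n : @rsubmx _ 1 d 1 (row_mx 0 (n%:M : 'M[int]_1)) 0 0 = n.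
    by rewrite row_mxKr mxE eqxx mulr1n.
  have e1 n : @src _ _ L (inr (row_mx 0 n%:M, false)) = (v1, n).
    by rewrite /= shl shr (vshift0 hG) addr0.
  have e2 n : @tgt _ _ L (inr (row_mx 0 n%:M, false)) = (v2, n + 1).
    by rewrite /= shl shr (vshift0 hG).
  have e3 n : @src _ _ L (inr (row_mx 0 n%:M, true)) = (v2, n + 1).
    by rewrite /= shl shr (vshift0 hG).
  have e4 n : @tgt _ _ L (inr (row_mx 0 n%:M, true)) = (v1, n).
    by rewrite /= shl shr (vshift0 hG) addr0.
  have up n : exists p, @walk _ _ L (v1, n) p (v1, n + 1).
    have [p hp] := inlayer v2 v1 (n + 1).
    exists (inr (row_mx 0 n%:M, false) :: p); split; first exact: e1.
    by rewrite e2.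
  have down n : exists p, @walk _ _ L (v1, n + 1) p (v1, n).
    have [p hp] := inlayer v1 v2 (n + 1).
    exists (p ++ [:: inr (row_mx 0 n%:M, true)]); apply: walk_cat hp _.
    by split; [exact: e3|exact: e4].
  have ups n (k : nat) : exists p, @walk _ _ L (v1, n) p (v1, n + k%:Z).
    elim: k => [|k [p hp]]; first by exists [::]; rewrite /= addr0.
    have [q hq] := up (n + k%:Z); exists (p ++ q); apply: walk_cat hp _.
    by rewrite intS addrCA addrC.
  have downs n (k : nat) : exists p, @walk _ _ L (v1, n + k%:Z) p (v1, n).
    elim: k => [|k [p hp]]; first by exists [::]; rewrite /= addr0.
    have [q hq] := down (n + k%:Z); exists (q ++ p); apply: walk_cat _ hp.
    by rewrite intS addrCA addrC.
  move=> [x m] [y n]; have [p hp] := inlayer x v1 m; have [q hq] := inlayer v1 y n.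
  have [r hr] : exists r, @walk _ _ L (v1, m) r (v1, n).
    case: (lerP m n) => mn.
      have [r hr] := ups m `|n - m|%N; exists r; move: hr.
      by rewrite gez0_abs ?subr_ge0 // subrKC.
    have [r hr] := downs n `|m - n|%N; exists r; move: hr.
    by rewrite gez0_abs ?subr_ge0 ?(ltW mn) // subrKC.
  by exists (p ++ (r ++ q)); apply: walk_cat hp _; apply: walk_cat hr _.
- move=> fL; apply: iG.
  have := finite_image (fun v : vertex G * int => v.1) fL.
  by apply: sub_finite_set => v _; exists (v, 0).
Qed.

(* Main.v *)
Require Import Defs.
From HB Require Import structures.
From mathcomp Require Import all_boot all_order all_algebra.
From mathcomp Require Import finmap.
From mathcomp Require Import all_classical all_reals all_analysis.
From mathcomp Require Import complex perm spectral sesquilinear zify ring lra.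

Set Implicit Arguments.
Unset Strict Implicit.
Unset Printing Implicit Defensive.

Import Order.TTheory GRing.Theory Num.Theory.
Import numFieldNormedType.Exports.
Local Open Scope classical_set_scope.
Local Open Scope ring_scope.

(** The fiber operator of the perturbed graph at [k] is that of the limit graph at
    [(k, <t, k>)], so its band edge is an extremum of the limit band function [F]
    over the points [p] of the torus with [<tt, p>] in [2 pi Z], [tt = (t, -1)].
    The characteristic polynomial of the fiber operator is a real combination of the
    [cos <n, k>] with coefficients polynomial in the spectral parameter; dividing it
    by its difference quotient at a simple root yields the expansion of [F] at [k0] up
    to [O(|x|^3)], and up to [O(|x|^4)] if [k0] is fixed by [k -> - k] modulo [2 pi].
    By Weyl's inequality [F] is continuous, so by compactness nearly extremal points
    are close to [k0] or [- k0] modulo [2 pi]. What remains is the minimum of the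
    quadratic form [x H x^T / 2] on [<tt, x> = - 2 pi alpha], which is
    [2 pi^2 alpha^2 / |H^(-1/2) tt|^2] and is attained at a point of size
    [O(1 / |t|)]. *)

(** * Hermitian matrices and square roots *)

(** The exponents come from scaling: the constrained minimizer has size [O(1 / |t|)], so a remainder
    [O(|x|^q)] in the expansion of [F] becomes [O(1 / |t|^q)]. The odd part of the expansion carries
    factors [sin <n, k0>], which vanish when every component of [k0] is [0] or [pi]; hence the
    passage from 3 to 4. The obstacle is that a band is an entry of a sorted list of roots, so
    nothing is known about its smoothness beforehand. Continuity comes from a comparison of whole
    matrices. The derivatives come from an exact product formula, the increment of [F] times a
    continuous factor being an explicit trigonometric expression. That formula also holds around
    points near [k0], which the Hessian, an iterated directional derivative, requires. With
    [sigma = - side_sign R s] the function [sigma * (F - F k0)] is nonnegative for both signs, so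
    only minima are treated. The constraint on [<tt, p>] and the function are both invariant under
    [p -> - p] and under translations by [2 pi]; this folds every nearly minimal point back to [k0].
    What is left of [<tt, k0>] is its distance to [2 pi Z], that is [2 pi |alpha|]. *)

Lemma char_poly_conj (F : fieldType) (n : nat) (P A : 'M[F]_n) :
  P \in unitmx -> char_poly (invmx P *m A *m P) = char_poly A.
Proof.
move=> Pu; rewrite /char_poly /char_poly_mx.
have -> : 'X%:M - map_mx polyC (invmx P *m A *m P) =
    map_mx polyC (invmx P) *m ('X%:M - map_mx polyC A) *m map_mx polyC P.
  rewrite mulmxBr mulmxBl !map_mxM; congr (_ - _).
  by rewrite scalar_mxC -mulmxA -map_mxM mulVmx // map_mx1 mulmx1.
rewrite !det_mulmx mulrAC -det_mulmx -map_mxM mulVmx //.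
by rewrite map_mx1 det1 mul1r.
Qed.

Section Unitary.
Local Open Scope sesquilinear_scope.

(* The first [j + 1] rows of [U] and the last [n - j] rows of [V] span subspaces
   whose dimensions add up to [n + 1]. *)
Lemma exists_common_vector (C : numClosedFieldType) (n j : nat) (U V : 'M[C]_n) :
  U \is unitarymx -> V \is unitarymx -> (j < n)%N ->
  exists x : 'rV[C]_n, [/\ x != 0,
    forall i : 'I_n, (j < i)%N -> (x *m U^t*) 0 i = 0 &
    forall i : 'I_n, (i < j)%N -> (x *m V^t*) 0 i = 0].
Proof.
move=> Uu Vu jn.
pose P : 'M[C]_n := pid_mx j.+1 *m U; pose Q := copid_mx j *m V.
have rP : \rank P = j.+1.
  by rewrite mxrankMfree ?rank_pid_mx // row_free_unit unitarymx_unit.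
have rQ : \rank Q = (n - j)%N.
  by rewrite mxrankMfree ?rank_copid_mx // ?row_free_unit ?unitarymx_unit // ltnW.
have cap_neq0 : (P :&: Q)%MS != 0.
  rewrite -mxrank_eq0 -lt0n; have := mxrank_sum_cap P Q.
  rewrite rP rQ; have := rank_leq_col (P + Q)%MS.
  move: (\rank _) (\rank _) => u v; lia.
pose x := nz_row (P :&: Q)%MS; exists x.
have /submxP [u xP] : (x <= P)%MS by apply: submx_trans (nz_row_sub _) (capmxSl _ _).
have /submxP [w xQ] : (x <= Q)%MS by apply: submx_trans (nz_row_sub _) (capmxSr _ _).
split; first by rewrite nz_row_eq0.
- move=> i ji; rewrite xP /P !mulmxA mulmxtVK // mxE big1 // => k _.
  rewrite mxE; case: (eqVneq k i) => [->|ki]; last first.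
    by rewrite (negPf (ki : k != i :> nat)) mulr0.
  by rewrite ltnS leqNgt ji andbF mulr0.
- move=> i ij; rewrite xQ /Q !mulmxA mulmxtVK // mxE big1 // => k _.
  rewrite !mxE; case: (eqVneq k i) => [->|ki]; last first.
    by rewrite (negPf (ki : k != i :> nat)) subr0 mulr0.
  by rewrite eqxx ij subrr mulr0.
Qed.

End Unitary.

(** * Sorted eigenvalues of Hermitian matrices and Weyl's inequality *)

Section Hermitian.
Local Open Scope sesquilinear_scope.
Local Open Scope complex_scope.
Variable R : realType.
Local Notation C := R[i].
Implicit Types n : nat.

(** The root list inside [sorted_eigenvalues] is known only through the product of its linear
    factors; unique factorization identifies it, up to order, with any real list of roots. *)
Lemma sorted_eigenvaluesE n (M : 'M[C]_n) (d : 'I_n -> R) :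
  char_poly M = \prod_i ('X - ((d i)%:C)%:P) ->
  perm_eq (sorted_eigenvalues M) [seq d i | i <- enum 'I_n].
Proof.
move=> cM; rewrite /sorted_eigenvalues perm_sort.
case: closed_field_poly_normal => r /= hr.
have : \prod_(z <- r) ('X - z%:P) = \prod_(z <- [seq (d i)%:C | i <- enum 'I_n]) ('X - z%:P).
  by rewrite big_map big_enum /= -cM hr (monicP (char_poly_monic M)) scale1r.
move=> /prod_XsubC_eq /(perm_map (@complex.Re R)) /perm_trans; apply.
by rewrite -map_comp.
Qed.

(** The spectral theorem leaves the eigenvalues unordered. The sorting permutation is applied to the
    rows of the unitary matrix as well, because the min-max argument needs eigenvectors indexed by
    rank. *)
Lemma hermitian_sorted_spectral n (M : 'M[C]_n) : M^t* = M ->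
  exists U : 'M[C]_n, exists d : 'rV[R]_n,
  [/\ U \is unitarymx,
      M = U^t* *m diag_mx (map_mx (real_complex R) d) *m U,
      forall i j : 'I_n, (i <= j)%N -> d 0 i <= d 0 j,
      forall i : 'I_n, nth 0 (sorted_eigenvalues M) i = d 0 i
    & char_poly M = \prod_i ('X - ((d 0 i)%:C)%:P)].
Proof.
move=> hM.
have Mh : M \is hermsymmx by apply/is_hermitianmxP; rewrite expr0 scale1r hM.
have /orthomx_spectralP eM := hermitian_normalmx Mh.
have dreal := hermitian_spectral_diag_real Mh.
have Uu := spectral_unitarymx M; have Uun := spectral_unit M.
move: (spectralmx M) (spectral_diag M) eM dreal Uu Uun => V e eM /mxOverP dreal Vu Vun.
pose d0 := map_mx (@complex.Re R) e.
have ed0 i : e 0 i = (d0 0 i)%:C by rewrite mxE RRe_real.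
have cM : char_poly M = \prod_i ('X - ((d0 0 i)%:C)%:P).
  rewrite eM char_poly_conj // char_poly_trig.
    by apply: eq_bigr => i _; rewrite mxE eqxx mulr1n ed0.
  by apply/is_trig_mxP => i j ij; rewrite mxE (ltn_eqF ij : i == j = false) mulr0n.
have pe := sorted_eigenvaluesE cM.
have sz : size (sorted_eigenvalues M) == n.
  by rewrite (perm_size pe) size_map size_enum_ord.
have pe' : perm_eq (Tuple sz) [tuple d0 0 i | i < n] by exact: pe.
have /tuple_permP [p hp] := pe'.
have nthE (i : 'I_n) : nth 0 (sorted_eigenvalues M) i = d0 0 (p i).
  rewrite [sorted_eigenvalues M]hp (nth_map i) ?size_enum_ord //.
  by rewrite nth_ord_enum tnth_mktuple.
exists (row_perm p V), (col_perm p d0); split.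
- apply/unitarymxP; rewrite tr_row_perm map_col_perm /= row_permE col_permE.
  rewrite mulmxA -[perm_mx p *m V *m _]mulmxA (unitarymxP Vu) mulmx1 -perm_mxM.
  by rewrite mulgV perm_mx1.
- rewrite [LHS]eM invmx_unitary //; apply/matrixP => i j; rewrite !mxE.
  rewrite (reindex_inj (@perm_inj _ p)) /=; apply: eq_bigr => k _.
  rewrite mul_mx_diag mul_mx_diag !mxE; congr (_ * _ * _).
  by have := ed0 (p k); rewrite mxE.
- have dE (i : 'I_n) : col_perm p d0 0 i = d0 0 (p i) by rewrite mxE.
  move=> i j ij; rewrite !dE -!nthE.
  apply: (sorted_leq_nth le_trans lexx) => //.
  + by apply: sort_sorted; exact: le_total.
  + by rewrite inE (eqP sz).
  + by rewrite inE (eqP sz).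
- by move=> i; rewrite nthE !mxE.
- rewrite cM (reindex_inj (@perm_inj _ p)) /=.
  by apply: eq_bigr => i _; rewrite !mxE.
Qed.

Definition sqnorm n (x : 'rV[C]_n) : C := \sum_i `|x 0 i| ^+ 2.

Lemma sqnorm_ge0 n (x : 'rV[C]_n) : 0 <= sqnorm x.
Proof. by apply: sumr_ge0 => i _; rewrite exprn_ge0. Qed.

Lemma sqnorm_eq0 n (x : 'rV[C]_n) : sqnorm x = 0 -> x = 0.
Proof.
move=> /eqP; rewrite psumr_eq0 => [/allP h|i _]; last by rewrite exprn_ge0.
apply/rowP => i; rewrite mxE; apply/eqP.
by have := h i (mem_index_enum i); rewrite sqrf_eq0 normr_eq0.
Qed.

Lemma diag_form n (d : 'rV[C]_n) (x : 'rV[C]_n) :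
  (x *m diag_mx d *m x^t*) 0 0 = \sum_i d 0 i * `|x 0 i| ^+ 2.
Proof.
rewrite mul_mx_diag mxE; apply: eq_bigr => i _.
by rewrite !mxE normCK mulrCA mulrA.
Qed.

Lemma sqnormE n (x : 'rV[C]_n) : sqnorm x = (x *m x^t*) 0 0.
Proof. by rewrite mxE; apply: eq_bigr => i _; rewrite !mxE normCK. Qed.

Lemma sqnorm_unitary n (U : 'M[C]_n) (x : 'rV[C]_n) :
  U \is unitarymx -> sqnorm (x *m U^t*) = sqnorm x.
Proof.
by move=> Uu; rewrite !sqnormE trmx_mul map_mxM trmxCK !mulmxA mulmxKtV.
Qed.

Lemma unitary_form n (U : 'M[C]_n) (d : 'rV[C]_n) (x : 'rV[C]_n) :
  (x *m (U^t* *m diag_mx d *m U) *m x^t*) 0 0 =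
  \sum_i d 0 i * `|(x *m U^t*) 0 i| ^+ 2.
Proof.
by rewrite -diag_form trmx_mul map_mxM trmxCK !mulmxA.
Qed.

(** Each product [|x i| * |x j|] is at most [sqnorm x], and there are [n ^ 2] of them; this crude
    constant is enough for continuity. *)
Lemma form_bound n (D : 'M[C]_n) (e : R) (x : 'rV[C]_n) :
  (forall i j, `|D i j| <= e%:C) ->
  `|(x *m D *m x^t*) 0 0| <= (n%:R ^+ 2 * e)%:C * sqnorm x.
Proof.
move=> hD; have xle i j : `|x 0 i| * `|x 0 j| <= sqnorm x.
  have h k : `|x 0 k| ^+ 2 <= sqnorm x.
    rewrite /sqnorm (bigD1 k) //= lerDl.
    by apply: sumr_ge0 => l _; rewrite exprn_ge0.
  have [a|a] := real_leP (normr_real (x 0 i)) (normr_real (x 0 j)).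
    by apply: le_trans (h j); rewrite expr2 ler_wpM2r.
  by apply: le_trans (h i); rewrite expr2 ler_wpM2l // ltW.
have -> : (x *m D *m x^t*) 0 0 = \sum_j \sum_i x 0 i * D i j * (x 0 j)^*.
  by rewrite mxE; apply: eq_bigr => j _; rewrite !mxE mulr_suml.
apply: le_trans (ler_norm_sum _ _ _) _.
have -> : (n%:R ^+ 2 * e)%:C * sqnorm x = \sum_(j < n) \sum_(i < n) e%:C * sqnorm x.
  rewrite !sumr_const card_ord -mulrnA -[RHS]mulr_natl natrM rmorphM rmorphXn /=.
  by rewrite rmorph_nat expr2 mulrA.
apply: ler_sum => j _; apply: le_trans (ler_norm_sum _ _ _) _.
apply: ler_sum => i _; rewrite !normrM norm_conjC mulrAC mulrC.
by apply: ler_pM => //; rewrite mulr_ge0.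
Qed.

(** On a common vector of the span of the first [j + 1] eigenvectors of [A] and of the last [n - j]
    of [B], the form of [A] is at most its j-th eigenvalue times [sqnorm x], and that of [B] at
    least its own. The form of [B - A] then bounds the gap. *)
Lemma weyl_le n (A B : 'M[C]_n) (e : R) (j : nat) : (j < n)%N ->
  A^t* = A -> B^t* = B -> (forall i k, `|B i k - A i k| <= e%:C) ->
  nth 0 (sorted_eigenvalues B) j <=
  nth 0 (sorted_eigenvalues A) j + n%:R ^+ 2 * e.
Proof.
move=> jn hA hB hAB.
have [U [a [Uu eA amono aE _]]] := hermitian_sorted_spectral hA.
have [V [b [Vu eB bmono bE _]]] := hermitian_sorted_spectral hB.
pose j0 := Ordinal jn.
have leb : nth 0 (sorted_eigenvalues B) j <= b 0 j0 by rewrite -(bE j0).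
have lea : a 0 j0 + n%:R ^+ 2 * e <= nth 0 (sorted_eigenvalues A) j + n%:R ^+ 2 * e.
  by rewrite lerD2r -(aE j0).
apply: le_trans leb (le_trans _ lea); rewrite leNgt; apply/negP => lt.
have [x [x0 yE zE]] := exists_common_vector Uu Vu jn.
have leA : (x *m A *m x^t*) 0 0 <= (a 0 j0)%:C * sqnorm x.
  rewrite eA unitary_form -(sqnorm_unitary x Uu) mulr_sumr.
  apply: ler_sum => i _; case: (leqP i j) => ij; last first.
    by rewrite yE // normr0 expr0n /= !mulr0.
  by rewrite ler_wpM2r ?exprn_ge0 // mxE lecR amono.
have leB : (b 0 j0)%:C * sqnorm x <= (x *m B *m x^t*) 0 0.
  rewrite eB unitary_form -(sqnorm_unitary x Vu) mulr_sumr.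
  apply: ler_sum => i _; case: (leqP j i) => ij; last first.
    by rewrite zE // normr0 expr0n /= !mulr0.
  by rewrite ler_wpM2r ?exprn_ge0 // mxE lecR bmono.
have hD i k : `|(B - A) i k| <= e%:C by rewrite !mxE.
have := form_bound x hD.
have : (b 0 j0 - a 0 j0)%:C * sqnorm x <= (x *m (B - A) *m x^t*) 0 0.
  have -> : (x *m (B - A) *m x^t*) 0 0 = (x *m B *m x^t*) 0 0 - (x *m A *m x^t*) 0 0.
    by rewrite mulmxBr mulmxBl !mxE.
  by rewrite rmorphB mulrBl lerB.
have e0 : 0 <= n%:R ^+ 2 * e.
  by apply: mulr_ge0; rewrite ?exprn_ge0 ?ler0n // -ler0c (le_trans _ (hAB j0 j0)).
have S0 : 0 < sqnorm x.
  by rewrite lt_neqAle sqnorm_ge0 andbT eq_sym; apply: contra_neq x0 => /sqnorm_eq0.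
move=> h1; rewrite ger0_norm => [h2|]; last first.
  by apply: le_trans h1; rewrite mulr_ge0 ?ler0c ?(ltW S0) // subr_ge0; lra.
by have := le_trans h1 h2; rewrite ler_pM2r // lecR; lra.
Qed.

End Hermitian.

Lemma poly_interpolation (F : fieldType) (f : F -> F) (s : seq F) :
  exists p : {poly F}, {in s, forall x, p.[x] = f x}.
Proof.
elim: s => [|a s [p hp]]; first by exists 0.
have [as_|as_] := boolP (a \in s).
  by exists p => x; rewrite inE => /orP[/eqP -> |]; exact: hp.
(* Newton's correction: [w] vanishes exactly at the earlier nodes, so a multiple of it changes the
   value at [a] only. *)
pose w := \prod_(b <- s) ('X - b%:P).
have wa : w.[a] != 0 by rewrite -[_ == 0]/(root _ _) root_prod_XsubC.
exists (p + ((f a - p.[a]) / w.[a]) *: w) => x; rewrite inE !hornerE.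
have [-> _|_ /= xs] := eqVneq x a; first by rewrite divfK // addrC subrK.
have /rootP -> : root w x by rewrite root_prod_XsubC.
by rewrite mulr0 addr0 hp.
Qed.

Lemma trmx_horner_mx (F : comNzRingType) (n : nat) (M : 'M[F]_n.+1) (p : {poly F}) :
  M^T = M -> (horner_mx M p)^T = horner_mx M p.
Proof.
move=> hM; elim/poly_ind: p => [|p c IH]; first by rewrite rmorph0 trmx0.
rewrite rmorphD rmorphM /= horner_mx_X horner_mx_C linearD /= tr_scalar_mx.
rewrite trmx_mul IH hM; congr (_ + _); symmetry; exact: comm_horner_mx.
Qed.

Lemma posdef_unitmx (R : realType) (n : nat) (M : 'M[R]_n) :
  posdef M -> M \in unitmx.
Proof.
move=> [_ M0]; rewrite -row_free_unit -kermx_eq0; apply: contraT => k0.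
have := M0 (nz_row (kermx M)); rewrite nz_row_eq0 => /(_ k0).
have /sub_kermxP -> := nz_row_sub (kermx M).
by rewrite mul0mx mxE ltxx.
Qed.

Lemma mulmx_tr_gt0 (R : realType) (n : nat) (x : 'rV[R]_n) :
  x != 0 -> 0 < (x *m x^T) 0 0.
Proof.
move=> x0; rewrite mxE lt_neqAle; apply/andP; split; last first.
  by apply: sumr_ge0 => i _; rewrite mxE -expr2 sqr_ge0.
apply: contra x0; rewrite eq_sym psumr_eq0 => [/allP h|i _]; last first.
  by rewrite mxE -expr2 sqr_ge0.
apply/eqP/rowP => i; have := h i (mem_index_enum i).
by rewrite !mxE -expr2 sqrf_eq0 => /eqP.
Qed.

Section SquareRoot.
Local Open Scope sesquilinear_scope.
Local Open Scope complex_scope.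

(* Interpolating the fourth root [p] on the spectrum gives a real symmetric
   [T = p(M)] with [T^4 = M]; the root is then [T^2], which is positive definite
   because [x T^2 x^T = |x T|^2]. *)
Lemma posdef_sqrt (R : realType) (n : nat) (M : 'M[R]_n) :
  posdef M -> exists S : 'M[R]_n, posdef S /\ S *m S = M.
Proof.
case: n M => [|n] M hM; first by exists M; split => //; rewrite [M]thinmx0 mulmx0.
have Mu := posdef_unitmx hM; case: hM => Msym Mpos.
pose Mc := map_mx (real_complex R) M.
have hMc : Mc^t* = Mc.
  by apply/matrixP => i j; rewrite !mxE -[in RHS]Msym mxE; exact: conjc_real.
have [U [d [Uu eM _ _ cM]]] := hermitian_sorted_spectral hMc.
(* The spectral theorem was applied to the complexification; a real root of [char_poly M] has a real
   eigenvector, on which positivity of [M] can be tested. *)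
have d0 i : 0 < d 0 i.
  have : root (char_poly M) (d 0 i).
    rewrite -(fmorph_root (real_complex R)) map_char_poly cM.
    rewrite -[X in root X _](big_map (fun i => (d 0 i)%:C) xpredT (fun z => 'X - z%:P)).
    by rewrite root_prod_XsubC; apply: map_f; rewrite mem_index_enum.
  rewrite -eigenvalue_root_char => /eigenvalueP[v vM v0].
  have := Mpos v v0; rewrite vM -scalemxAl mxE.
  by rewrite pmulr_lgt0 // mulmx_tr_gt0.
have [p hp] := poly_interpolation (fun x => Num.sqrt (Num.sqrt x))
  [seq d 0 i | i <- enum 'I_n.+1].
have pE i : p.[d 0 i] ^+ 4 = d 0 i.
  rewrite hp ?map_f ?mem_enum // (exprM _ 2 2) !sqr_sqrtr ?sqrtr_ge0 //.
  exact: ltW.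
pose T := horner_mx M p.
have TE : T ^+ 4 = M.
  (* The polynomial [p ^ 4 - X] vanishes on the spectrum, hence at the diagonalized matrix. *)
  apply/eqP; rewrite -subr_eq0 -[X in _ - X]horner_mx_X -rmorphXn -rmorphB /=.
  rewrite -(map_mx_eq0 (real_complex R)) map_horner_mx -/Mc eM -invmx_unitary //.
  rewrite horner_mx_uconjC; last exact: unitarymx_unit.
  rewrite horner_mx_diag; set e := map_mx _ _.
  suff -> : e = 0 by rewrite linear0 mulmx0 mul0mx.
  apply/rowP => i; rewrite !mxE rmorphB rmorphXn /= map_polyX !hornerE.
  by rewrite horner_map -rmorphXn pE subrr.
have Tsym : T^T = T by exact: trmx_horner_mx.
have Tu : T \in unitmx.
  have := Mu; rewrite -TE exprSr unitmx_mul => /andP[_ //].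
exists (T *m T); split; last by rewrite !mulmxE -TE !exprS expr0 mulr1 !mulrA.
split; first by rewrite trmx_mul Tsym.
move=> x x0; rewrite mulmxA -mulmxA -{2}Tsym -trmx_mul mulmx_tr_gt0 //.
apply: contra x0 => /eqP h; rewrite -[x](mulmxK Tu) h mul0mx //.
Qed.

Lemma possqrtP (R : realType) (n : nat) (M : 'M[R]_n) :
  posdef M -> posdef (possqrt M) /\ possqrt M *m possqrt M = M.
Proof.
move=> /posdef_sqrt[S hS]; rewrite /possqrt; case: xgetP => [S' _ //|].
by move=> /(_ S) /(_ hS).
Qed.

End SquareRoot.

(** * Taylor bounds and orders of vanishing *)

Section TrigBounds.
Variable R : realType.

(** By the mean value theorem. It is applied four times in a chain: the bound proved for sine or
    cosine is the sign of the derivative in the next one. *)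
Lemma ge0_of_derive (f f' : R -> R) : (forall x : R, is_derive x (1 : R) f (f' x)) ->
  f 0 = 0 -> (forall x, 0 <= x -> 0 <= f' x) -> forall x, 0 <= x -> 0 <= f x.
Proof.
move=> df f0 f'0 x x0.
have [//|c] := @MVT_segment R f f' 0 x x0 (fun c _ => df c).
  by apply: derivable_within_continuous => c _; have [] := df c.
rewrite in_itv /= => /andP[c0 _]; rewrite f0 !subr0 => ->.
by rewrite mulr_ge0 // f'0.
Qed.

Lemma sin_le_id (x : R) : 0 <= x -> sin x <= x.
Proof.
have df (y : R) : is_derive y (1 : R) (fun x => x - sin x) (1 - cos y).
  exact: is_deriveB.
move=> x0; rewrite -subr_ge0; apply: (ge0_of_derive df) => //.
by rewrite sin0 subr0.
Qed.

Lemma cos_ge_quad (x : R) : 0 <= x -> 1 - x ^+ 2 / 2 <= cos x.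
Proof.
have df (y : R) : is_derive y (1 : R) (fun x => cos x - (1 - x ^+ 2 / 2)) (y - sin y).
  by apply: is_derive_eq; rewrite /GRing.scale /=; lra.
move=> x0; rewrite -subr_ge0; apply: (ge0_of_derive df) => //.
  by rewrite cos0 expr0n /= mul0r subr0 subrr.
by move=> y y0; rewrite subr_ge0 sin_le_id.
Qed.

Lemma sin_ge_cubic (x : R) : 0 <= x -> x - x ^+ 3 / 6 <= sin x.
Proof.
have df (y : R) : is_derive y (1 : R) (fun x => sin x - (x - x ^+ 3 / 6))
    (cos y - (1 - y ^+ 2 / 2)).
  by apply: is_derive_eq; rewrite /GRing.scale /=; lra.
move=> x0; rewrite -subr_ge0; apply: (ge0_of_derive df) => //.
  by rewrite sin0 expr0n /= mul0r !subr0.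
by move=> y y0; rewrite subr_ge0 cos_ge_quad.
Qed.

Lemma cos_le_quartic (x : R) : 0 <= x -> cos x <= 1 - x ^+ 2 / 2 + x ^+ 4 / 24.
Proof.
have df (y : R) : is_derive y (1 : R) (fun x => 1 - x ^+ 2 / 2 + x ^+ 4 / 24 - cos x)
    (sin y - (y - y ^+ 3 / 6)).
  by apply: is_derive_eq; rewrite /GRing.scale /=; lra.
move=> x0; rewrite -subr_ge0; apply: (ge0_of_derive df) => //.
  by rewrite cos0 !expr0n /= !mul0r subr0 addr0 subrr.
by move=> y y0; rewrite subr_ge0 sin_ge_cubic.
Qed.

Lemma cos_taylor (x : R) : `|cos x - 1 + x ^+ 2 / 2| <= `|x| ^+ 4.
Proof.
rewrite -cos_norm -[x ^+ 2]real_normK ?num_real //.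
move: `|x| (normr_ge0 x) => y y0.
have h : 0 <= y ^+ 4 by rewrite exprn_ge0.
rewrite ler_norml; apply/andP; split.
  have := cos_ge_quad y0; lra.
have := cos_le_quartic y0; lra.
Qed.

Lemma sin_taylor (x : R) : `|sin x - x| <= `|x| ^+ 3.
Proof.
wlog x0 : x / 0 <= x => [H|].
  have [|/ltW x0] := leP 0 x; first exact: H.
  have := H (- x); rewrite oppr_ge0 normrN => /(_ x0).
  by rewrite sinN -opprD normrN.
rewrite (ger0_norm x0) ler_norml.
have h : 0 <= x ^+ 3 by rewrite exprn_ge0.
have := sin_le_id x0; have := sin_ge_cubic x0.
by move=> h1 h2; apply/andP; split; lra.
Qed.

End TrigBounds.

Section Ord.
Variables (R : realType) (n : nat).
Implicit Types (f g : 'rV[R]_n -> R) (p q : nat).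

(** Landau's [O(|x|^p)] at the origin, in the sup norm; [ord 0] is boundedness near 0. No sign is
    imposed on [C], so proofs pass to its absolute value where monotonicity matters. *)
Definition ord p f := exists C, \forall x \near (0 : 'rV[R]_n), `|f x| <= C * `|x| ^+ p.

Lemma ord_near p f g : (\forall x \near (0 : 'rV[R]_n), f x = g x) -> ord p f -> ord p g.
Proof.
move=> fg [C hC]; exists C; near=> x; have <- : f x = g x by near: x.
by near: x.
Unshelve. all: by end_near. Qed.

Lemma ord_eq p f g : f =1 g -> ord p f -> ord p g.
Proof. by move=> fg; apply: ord_near; near=> x. Unshelve. all: by end_near. Qed.

Lemma ordD p f g : ord p f -> ord p g -> ord p (fun x => f x + g x).
Proof.
move=> [C hC] [D hD]; exists (C + D); near=> x.
rewrite mulrDl; apply: le_trans (ler_normD _ _) _; apply: lerD; by near: x.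
Unshelve. all: by end_near. Qed.

Lemma ordM p q f g : ord p f -> ord q g -> ord (p + q) (fun x => f x * g x).
Proof.
move=> [C hC] [D hD]; exists (C * D); near=> x.
rewrite normrM exprD mulrACA; apply: ler_pM => //; by near: x.
Unshelve. all: by end_near. Qed.

Lemma ordZ p c f : ord p f -> ord p (fun x => c * f x).
Proof.
move=> [C hC]; exists (`|c| * C); near=> x.
by rewrite normrM -mulrA ler_wpM2l //; near: x.
Unshelve. all: by end_near. Qed.

Lemma ordN p f : ord p f -> ord p (fun x => - f x).
Proof. by move=> /(ordZ (-1)); apply: ord_eq => x; rewrite mulN1r. Qed.

Lemma ord_zero p : ord p (fun=> 0).
Proof. by exists 0; near=> x; rewrite normr0 mul0r. Unshelve. all: by end_near. Qed.

Lemma ord_sum p (I : eqType) (r : seq I) (F : I -> 'rV[R]_n -> R) :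
  (forall i, i \in r -> ord p (F i)) -> ord p (fun x => \sum_(i <- r) F i x).
Proof.
elim: r => [|i r IH] h.
  by apply: ord_eq (ord_zero p) => x; rewrite big_nil.
apply: (@ord_eq _ (fun x => F i x + \sum_(j <- r) F j x)).
  by move=> x; rewrite big_cons.
by apply: ordD; [apply: h; rewrite mem_head|apply: IH => j jr; apply: h; rewrite inE jr orbT].
Qed.

Lemma ord_le p q f : (q <= p)%N -> ord p f -> ord q f.
Proof.
move=> qp [C hC]; exists `|C|; near=> x.
have : `|f x| <= C * `|x| ^+ p by near: x.
move=> /le_trans; apply; apply: (@le_trans _ _ (`|C| * `|x| ^+ p)).
  by rewrite ler_wpM2r ?exprn_ge0 ?ler_norm.
rewrite ler_wpM2l // ler_wiXn2l //.
Unshelve. all: by end_near. Qed.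

Lemma ord_bounded f (M : R) : (\forall x \near (0 : 'rV[R]_n), `|f x| <= M) -> ord 0 f.
Proof.
by move=> h; exists M; near=> x; rewrite expr0 mulr1; near: x.
Unshelve. all: by end_near. Qed.

Lemma ord_cvg f (l : R) : f x @[x --> (0 : 'rV[R]_n)] --> l -> ord 0 f.
Proof.
move=> fl; apply: (@ord_bounded _ (`|l| + 1)); near=> x.
have : `|l - f x| < 1 by near: x; move: fl => /cvgrPdist_lt; exact.
move=> h; rewrite -[f x](subrK l) -normrN opprD opprB.
by apply: le_trans (ler_normD _ _) _; rewrite normrN addrC lerD2l ltW.
Unshelve. all: by end_near. Qed.

Lemma ord_comp p q f (u : R -> R) C : (forall t, `|u t| <= C * `|t| ^+ q) -> 0 <= C ->
  ord p f -> ord (p * q) (fun x => u (f x)).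
Proof.
move=> hu C0 [D hD]; exists (C * D ^+ q); near=> x.
apply: le_trans (hu _) _; rewrite -mulrA ler_wpM2l // exprM -exprMn.
have h : `|f x| <= D * `|x| ^+ p by near: x.
by apply: lerXn2r => //; rewrite nnegrE (le_trans _ h).
Unshelve. all: by end_near. Qed.

End Ord.

(** * Expansion of a simple band at an extremum *)

Section Dotp.
Variables (R : realType) (n : nat).
Implicit Types x y z : 'rV[R]_n.

Lemma dotpC x y : dotp x y = dotp y x.
Proof. by apply: eq_bigr => i _; rewrite mulrC. Qed.

Lemma dotpDr x y z : dotp x (y + z) = dotp x y + dotp x z.
Proof. by rewrite -big_split; apply: eq_bigr => i _; rewrite mxE mulrDr. Qed.

Lemma dotpDl x y z : dotp (x + y) z = dotp x z + dotp y z.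
Proof. by rewrite dotpC dotpDr ![dotp z _]dotpC. Qed.

Lemma dotpZr x c y : dotp x (c *: y) = c * dotp x y.
Proof. by rewrite mulr_sumr; apply: eq_bigr => i _; rewrite mxE mulrCA. Qed.

Lemma dotpNr x y : dotp x (- y) = - dotp x y.
Proof. by rewrite -scaleN1r dotpZr mulN1r. Qed.

Lemma dotpNl x y : dotp (- x) y = - dotp x y.
Proof. by rewrite dotpC dotpNr dotpC. Qed.

Lemma dotp0r x : dotp x 0 = 0.
Proof. by rewrite -(scale0r 0) dotpZr mul0r. Qed.

Lemma dotp0l x : dotp 0 x = 0.
Proof. by rewrite dotpC dotp0r. Qed.

Lemma dotp_delta x i : dotp x (delta_mx 0 i) = x 0 i.
Proof.
rewrite /dotp (bigD1 i) //= big1 => [|j ji].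
  by rewrite mxE !eqxx mulr1 addr0.
by rewrite mxE (negPf ji) mulr0.
Qed.

Lemma dotpE x y : dotp x y = (x *m y^T) 0 0.
Proof. by rewrite mxE; apply: eq_bigr => i _; rewrite mxE. Qed.

Lemma coord_le_norm x i : `|x 0 i| <= `|x|.
Proof.
have -> : `|x| = mx_norm x by [].
rewrite mx_normrE.
exact: (le_bigmax _ (fun ij : 'I_1 * 'I_n => `|x ij.1 ij.2|) (0, i)).
Qed.

Lemma dotp_le_norm x y : `|dotp x y| <= (\sum_i `|x 0 i|) * `|y|.
Proof.
apply: le_trans (ler_norm_sum _ _ _) _; rewrite mulr_suml.
by apply: ler_sum => i _; rewrite normrM ler_wpM2l // coord_le_norm.
Qed.

End Dotp.

Lemma dotp_row_mx (R : realType) (m n : nat) (x y : 'rV[R]_m) (z w : 'rV[R]_n) :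
  dotp (row_mx x z) (row_mx y w) = dotp x y + dotp z w.
Proof. by rewrite !dotpE tr_row_mx mul_row_col mxE. Qed.

Lemma cvg_sumr (R : realType) (T : Type) (F : set_system T) {FF : Filter F}
    (I : Type) (r : seq I) (f : I -> T -> R) (l : I -> R) :
  (forall i, f i x @[x --> F] --> l i) ->
  (\sum_(i <- r) f i x) @[x --> F] --> \sum_(i <- r) l i.
Proof.
move=> fl; elim: r => [|i r IH].
  under eq_fun do rewrite big_nil; rewrite big_nil; exact: cvg_cst.
under eq_fun do rewrite big_cons; rewrite big_cons.
exact: cvgD (fl i) IH.
Qed.

Lemma dotp_continuous (R : realType) (n : nat) (x : 'rV[R]_n) : continuous (dotp x).
Proof.
move=> y; apply: (@cvg_sumr R _ (nbhs y) _ _ _ (fun i z => x 0 i * z 0 i)) => i.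
by apply: cvgMl_tmp; exact: coord_continuous.
Qed.

Lemma derive_increment (R : realType) (f : R -> R) (l : R) :
  is_derive (0 : R) (1 : R) f l -> h^-1 * (f h - f 0) @[h --> 0^'] --> l.
Proof.
move=> [d <-]; rewrite /derive; move: d; rewrite /derivable.
have -> : (fun h : R => h^-1 *: ((f \o shift 0) (h *: (1 : R)) - f 0)) =
    fun h => h^-1 * (f h - f 0) => //.
by apply/funext => h; rewrite /= addr0 /GRing.scale /= mulr1.
Qed.

Lemma cos_increment (R : realType) (a b : R) :
  h^-1 * (cos (a + h * b) - cos a) @[h --> 0^'] --> - (b * sin a).
Proof.
have d : is_derive (0 : R) (1 : R) (fun h => cos (a + h * b)) (- (b * sin a)).
  by apply: is_derive_eq; rewrite /GRing.scale /= mul0r !(addr0, add0r); ring.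
by have := derive_increment d; rewrite mul0r addr0.
Qed.

Lemma sin_increment (R : realType) (a b : R) :
  h^-1 * (sin (a + h * b) - sin a) @[h --> 0^'] --> b * cos a.
Proof.
have d : is_derive (0 : R) (1 : R) (fun h => sin (a + h * b)) (b * cos a).
  by apply: is_derive_eq; rewrite /GRing.scale /= mul0r !(addr0, add0r); ring.
by have := derive_increment d; rewrite mul0r addr0.
Qed.

Section LocalExpansion.
Variables (R : realType) (n : nat) (s : seq ({poly R} * 'rV[int]_n)).
Variables (F : 'rV[R]_n -> R) (k0 : 'rV[R]_n) (sigma : R).

(** Models a characteristic polynomial: each pair of [s] holds a coefficient, itself a polynomial in
    the spectral parameter, and a frequency. *)
Definition trig_poly (k : 'rV[R]_n) : {poly R} :=
  \sum_(z <- s) cos (dotp (toR R z.2) k) *: z.1.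

(** Being a polynomial, it is also defined on the diagonal, where its value is the derivative. *)
Definition diff_quot (c : {poly R}) (a : R) : {poly R} := (c - c.[a]%:P) %/ ('X - a%:P).

Lemma diff_quotP c a : c = c.[a]%:P + ('X - a%:P) * diff_quot c a.
Proof.
have d : 'X - a%:P %| c - c.[a]%:P.
  by rewrite dvdp_XsubCl; apply/rootP; rewrite !hornerE subrr.
by rewrite [('X - _) * _]mulrC /diff_quot divpK // addrC subrK.
Qed.

Lemma horner_diff_quot c a b : c.[b] - c.[a] = (b - a) * (diff_quot c a).[b].
Proof. by rewrite {1}(diff_quotP c a) !hornerE addrC addKr. Qed.

Lemma diff_quot_diag c a : (diff_quot c a).[a] = c^`().[a].
Proof.
rewrite {2}(diff_quotP c a) derivD derivC add0r derivM derivXsubC mul1r.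
by rewrite !hornerE subrr mul0r addr0.
Qed.

Local Notation ph z k := (dotp (toR R z.2) k).
Local Notation dtrig y := ((trig_poly y)^`().[F y]).

Lemma horner_trig_poly k l : (trig_poly k).[l] = \sum_(z <- s) cos (ph z k) * z.1.[l].
Proof. by rewrite horner_sum; apply: eq_bigr => z _; rewrite hornerZ. Qed.

Lemma horner_deriv_trig_poly k l :
  (trig_poly k)^`().[l] = \sum_(z <- s) cos (ph z k) * z.1^`().[l].
Proof.
by rewrite raddf_sum horner_sum /=; apply: eq_bigr => z _; rewrite derivZ hornerZ.
Qed.

Hypothesis rootF : forall k, (trig_poly k).[F k] = 0.
Hypothesis contF : continuous F.
Hypothesis simpleF : dtrig k0 != 0.
Hypothesis sigma_neq0 : sigma != 0.
Hypothesis extrF : forall k, 0 <= sigma * (F k - F k0).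

(** The difference quotient of [trig_poly k] in the spectral parameter, between [F y] and [F k]. *)
Definition trig_quot y k := \sum_(z <- s) cos (ph z k) * (diff_quot z.1 (F y)).[F k].

(* Dividing by [trig_quot], which is continuous and nonzero near a simple root,
   replaces the implicit function theorem. *)
Lemma root_increment y k : (F k - F y) * trig_quot y k = - (trig_poly k).[F y].
Proof.
rewrite -[RHS]add0r -(rootF k) !horner_trig_poly -sumrB mulr_sumr.
by apply: eq_bigr => z _; rewrite -mulrBr horner_diff_quot mulrCA.
Qed.

Lemma trig_quot_diag y : trig_quot y y = dtrig y.
Proof.
by rewrite horner_deriv_trig_poly; apply: eq_bigr => z _; rewrite diff_quot_diag.
Qed.

Lemma cos_ph_continuous (z : {poly R} * 'rV[int]_n) : continuous (fun k => cos (ph z k) : R).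
Proof.
move=> k; apply: continuous_comp; first exact: dotp_continuous.
exact: continuous_cos.
Qed.

Lemma sin_ph_continuous (z : {poly R} * 'rV[int]_n) : continuous (fun k => sin (ph z k) : R).
Proof.
move=> k; apply: continuous_comp; first exact: dotp_continuous.
exact: continuous_sin.
Qed.

Lemma hornerF_continuous p : continuous (fun k => p.[F k]).
Proof.
move=> k; apply: (continuous_comp (contF (x := k))).
exact: continuous_horner.
Qed.

Lemma trig_quot_continuous y : continuous (trig_quot y).
Proof.
move=> k; apply: (@cvg_sumr R _ (nbhs k) _ _ _
  (fun z k => cos (ph z k) * (diff_quot z.1 (F y)).[F k])) => z.
by apply: cvgM; [exact: cos_ph_continuous|exact: hornerF_continuous].
Qed.

Lemma dtrig_continuous : continuous (fun y => dtrig y).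
Proof.
have -> : (fun y => dtrig y) = (fun y => \sum_(z <- s) cos (ph z y) * z.1^`().[F y]).
  by apply/funext => y; rewrite horner_deriv_trig_poly.
move=> k; apply: (@cvg_sumr R _ (nbhs k) _ _ _
  (fun z k => cos (ph z k) * z.1^`().[F k])) => z.
by apply: cvgM; [exact: cos_ph_continuous|exact: hornerF_continuous].
Qed.

Lemma line_cvg (v y : 'rV[R]_n) : h *: v + y @[h --> (0 : R)^'] --> y.
Proof.
rewrite -[X in _ --> X]add0r -(scale0r v).
apply: cvgD; last exact: cvg_cst.
by apply: cvgZr_tmp; apply: nbhs_dnbhs.
Qed.

(** Minus the derivative along [v] of [trig_poly] at [y], the spectral parameter [l] being frozen;
    the sign absorbs the minus of [root_increment]. *)
Definition trig_grad v y l : R := \sum_(z <- s) z.1.[l] * ph z v * sin (ph z y).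

Lemma trig_poly_increment v y l :
  h^-1 * ((trig_poly (h *: v + y)).[l] - (trig_poly y).[l]) @[h --> 0^'] -->
  - trig_grad v y l.
Proof.
have -> : (fun h => h^-1 * ((trig_poly (h *: v + y)).[l] - (trig_poly y).[l])) =
  fun h => \sum_(z <- s) z.1.[l] * (h^-1 * (cos (ph z y + h * ph z v) - cos (ph z y))).
  apply/funext => h; rewrite !horner_trig_poly -sumrB mulr_sumr.
  by apply: eq_bigr => z _; rewrite dotpDr dotpZr [_ + ph z y]addrC; ring.
rewrite /trig_grad -sumrN; apply: (@cvg_sumr R _ (0 : R)^' _ _ _
  (fun z h => z.1.[l] * (h^-1 * (cos (ph z y + h * ph z v) - cos (ph z y))))) => z.
by rewrite -mulrA -mulrN; apply: cvgMl_tmp; exact: cos_increment.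
Qed.

(** Divide [root_increment] by [h]: the right side tends to [trig_grad] and the factor [trig_quot]
    to [dtrig y]. So [F] has directional derivatives wherever the root is simple, with only its
    continuity known beforehand. *)
Lemma band_increment v y : dtrig y != 0 ->
  h^-1 *: ((F \o shift y) (h *: v) - F y) @[h --> (0 : R)^'] -->
  trig_grad v y (F y) / dtrig y.
Proof.
move=> y0.
have tq : trig_quot y (h *: v + y) @[h --> (0 : R)^'] --> dtrig y.
  rewrite -trig_quot_diag; apply: (cvg_comp _ _ (@line_cvg v y)).
  exact: trig_quot_continuous.
have lim : - (h^-1 * ((trig_poly (h *: v + y)).[F y] - (trig_poly y).[F y]))
     / trig_quot y (h *: v + y) @[h --> (0 : R)^'] --> trig_grad v y (F y) / dtrig y.
  apply: cvgM; last exact: cvgV.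
  by rewrite -[X in _ --> X]opprK; apply: cvgN; exact: trig_poly_increment.
apply: cvg_trans lim; apply: near_eq_cvg; near=> h.
have t0 : trig_quot y (h *: v + y) != 0 by near: h; exact: (cvgr_neq0 _ tq).
rewrite /= rootF subr0 -mulrN -root_increment mulrA mulfK //.
Unshelve. all: by end_near. Qed.

Lemma derive_band v y : dtrig y != 0 -> 'D_v F y = trig_grad v y (F y) / dtrig y.
Proof. by move=> /band_increment h; apply: cvg_lim => //; exact: h. Qed.

(* The difference quotients at the extremum along [v] and [- v] have a
   nonnegative product and opposite limits. *)
Lemma trig_grad_k0 v : trig_grad v k0 (F k0) = 0.
Proof.
have h1 := band_increment (v := v) simpleF.
have h2 := band_increment (v := - v) simpleF.
have gN : trig_grad (- v) k0 (F k0) = - trig_grad v k0 (F k0).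
  by rewrite /trig_grad -sumrN; apply: eq_bigr => z _; rewrite dotpNr mulrN mulNr.
have := cvgM h1 h2; rewrite gN mulNr mulrN => /(_ _) h.
have : 0 <= - (trig_grad v k0 (F k0) / dtrig k0 * (trig_grad v k0 (F k0) / dtrig k0)).
  rewrite -(cvg_lim (@norm_hausdorff _ _) h); apply: limr_ge; first exact: cvgP h.
  near=> x; rewrite /= /GRing.scale /=.
  (* Only [sigma] times an increment has a known sign, so the square of [x^-1 / sigma] is pulled
     out. *)
  have -> : forall a b : R, x^-1 * a * (x^-1 * b) =
      (x^-1 / sigma) ^+ 2 * ((sigma * a) * (sigma * b)).
    by move=> a b; field; rewrite sigma_neq0; near: x; exact: nbhs_dnbhs_neq.
  by rewrite mulr_ge0 ?sqr_ge0 // mulr_ge0.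
rewrite -expr2 oppr_ge0 => h0; apply/eqP.
have := sqr_ge0 (trig_grad v k0 (F k0) / dtrig k0) => h3.
have /eqP : (trig_grad v k0 (F k0) / dtrig k0) ^+ 2 = 0 by apply: le_anti; rewrite h0 h3.
by rewrite sqrf_eq0 mulf_eq0 invr_eq0 (negPf simpleF) orbF.
Unshelve. all: by end_near. Qed.

(** The second derivatives at [k0] involve first derivatives at neighbouring points, where the root
    must still be simple. *)
Lemma near_dtrig_neq0 : \forall y \near k0, dtrig y != 0.
Proof. exact: (cvgr_neq0 _ (@dtrig_continuous k0)). Qed.

Definition weight (z : {poly R} * 'rV[int]_n) : R := z.1.[F k0] * cos (ph z k0).

(** Moving the phase gives the terms [a], moving the spectral value gives the terms [c]. The latter
    carry the difference quotient of [F], which tends to 0 at the extremum. *)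
Lemma trig_grad_increment v w :
  h^-1 * trig_grad w (h *: v + k0) (F (h *: v + k0)) @[h --> (0 : R)^'] -->
  \sum_(z <- s) weight z * (ph z v * ph z w).
Proof.
pose c z y := (diff_quot z.1 (F k0)).[F y] * ph z w * sin (ph z y).
pose a h z := z.1.[F k0] * ph z w *
  (h^-1 * (sin (ph z k0 + h * ph z v) - sin (ph z k0))).
have -> : (fun h => h^-1 * trig_grad w (h *: v + k0) (F (h *: v + k0))) =
  fun h => \sum_(z <- s) a h z
     + (h^-1 *: ((F \o shift k0) (h *: v) - F k0)) * \sum_(z <- s) c z (h *: v + k0).
  apply/funext => h; rewrite -[LHS]subr0 -[X in _ - X](mulr0 h^-1).
  rewrite -[X in _ - _ * X](trig_grad_k0 w) -mulrBr /trig_grad.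
  rewrite -sumrB !mulr_sumr -big_split; apply: eq_bigr => z _ /=.
  rewrite /a /c dotpDr dotpZr [_ + ph z k0]addrC /GRing.scale /=.
  have := horner_diff_quot z.1 (F k0) (F (h *: v + k0)) => /(canRL (subrK _)) ->.
  by ring.
rewrite -[X in _ --> X]addr0; apply: cvgD.
  apply: (@cvg_sumr R _ (0 : R)^' _ _ _ (fun z h => a h z)) => z; rewrite /a.
  have -> : weight z * (ph z v * ph z w) =
      z.1.[F k0] * ph z w * (ph z v * cos (ph z k0)) by rewrite /weight; ring.
  by apply: cvgMl_tmp; exact: sin_increment.
rewrite -[X in _ --> X](mul0r (\sum_(z <- s) c z k0)); apply: cvgM.
  by have := band_increment (v := v) simpleF; rewrite trig_grad_k0 mul0r.
apply: (cvg_comp (fun h => h *: v + k0) (fun y => \sum_(z <- s) c z y) (@line_cvg v k0)).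
apply: (@cvg_sumr R _ (nbhs k0) _ _ _ c) => z.
rewrite /c; apply: cvgM; last exact: sin_ph_continuous.
by apply: cvgMr_tmp; exact: hornerF_continuous.
Qed.

(** The first derivatives are [trig_grad / dtrig] near [k0]. As [trig_grad] vanishes at [k0], the
    variation of the denominator does not contribute. *)
Lemma Hess_band :
  Hess F k0 = (dtrig k0)^-1 *:
    \sum_(z <- s) weight z *: ((toR R z.2)^T *m toR R z.2).
Proof.
apply/matrixP => i j; rewrite !mxE summxE mulrC mulr_suml.
rewrite [RHS](_ : _ = (\sum_(z <- s) weight z *
   (ph z (delta_mx 0 i) * ph z (delta_mx 0 j))) / dtrig k0); last first.
  rewrite mulr_suml; apply: eq_bigr => z _; rewrite !dotp_delta 2!mxE.
  by rewrite big_ord1 !mxE.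
apply: cvg_lim => //=.
have lim : (h^-1 * trig_grad (delta_mx 0 j) (h *: delta_mx 0 i + k0)
      (F (h *: delta_mx 0 i + k0))) / dtrig (h *: delta_mx 0 i + k0)
    @[h --> (0 : R)^'] --> (\sum_(z <- s) weight z *
   (ph z (delta_mx 0 i) * ph z (delta_mx 0 j))) / dtrig k0.
  apply: cvgM; first exact: trig_grad_increment.
  apply: cvgV => //.
  apply: (cvg_comp (fun h => h *: delta_mx 0 i + k0) (fun y => dtrig y)
    (@line_cvg (delta_mx 0 i) k0)).
  exact: dtrig_continuous.
apply: cvg_trans lim; apply: near_eq_cvg; near=> h.
have t0 : dtrig (h *: delta_mx 0 i + k0) != 0.
  by near: h; exact: (@line_cvg (delta_mx 0 i) k0 _ near_dtrig_neq0).
rewrite /= (derive_band _ t0) (derive_band _ simpleF) trig_grad_k0 mul0r subr0.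
by rewrite /GRing.scale /= mulrA.
Unshelve. all: by end_near. Qed.

Lemma Hess_form x : (x *m Hess F k0 *m x^T) 0 0 =
  (\sum_(z <- s) weight z * ph z x ^+ 2) / dtrig k0.
Proof.
rewrite Hess_band -scalemxAr -scalemxAl mxE mulrC; congr (_ * _).
rewrite mulmx_sumr mulmx_suml summxE; apply: eq_bigr => z _.
rewrite -scalemxAr -scalemxAl mxE expr2; congr (_ * _).
rewrite mulmxA -[_ *m _ *m x^T]mulmxA mxE (big_ord1 _ (fun j => _ * _)) -!dotpE.
by rewrite dotpC.
Qed.

Lemma ord_ph (z : {poly R} * 'rV[int]_n) : ord 1 (fun x => ph z x).
Proof.
exists (\sum_i `|toR R z.2 0 i|); near=> x; rewrite expr1; exact: dotp_le_norm.
Unshelve. all: by end_near. Qed.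

Definition base_value (x : 'rV[R]_n) := (trig_poly (k0 + x)).[F k0].

(* The linear terms cancel by [trig_grad_k0]; odd terms of higher order come from
   the sines only. *)
Lemma base_value_expansion :
  ord 3 (fun x => base_value x + 2^-1 * \sum_(z <- s) weight z * ph z x ^+ 2) /\
  ((forall z, z \in s -> sin (ph z k0) = 0) ->
   ord 4 (fun x => base_value x + 2^-1 * \sum_(z <- s) weight z * ph z x ^+ 2)).
Proof.
pose C z x := weight z * (cos (ph z x) - 1 + ph z x ^+ 2 / 2).
pose S z x := z.1.[F k0] * sin (ph z k0) * (sin (ph z x) - ph z x).
have oC : ord 4 (fun x => \sum_(z <- s) C z x).
  apply: ord_sum => z _; apply: ordZ.
  apply: (@ord_comp _ _ 1 4 _ (fun t => cos t - 1 + t ^+ 2 / 2) 1) => //.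
    by move=> t; rewrite mul1r cos_taylor.
  exact: ord_ph.
have E x : base_value x + 2^-1 * \sum_(z <- s) weight z * ph z x ^+ 2 =
    \sum_(z <- s) C z x - \sum_(z <- s) S z x.
  have w0 : \sum_(z <- s) weight z = 0.
    rewrite -[RHS](rootF k0) horner_trig_poly; apply: eq_bigr => z _.
    by rewrite /weight mulrC.
  have g0 := trig_grad_k0 x.
  (* The value and the gradient at [k0], both zero, are inserted so that each cosine and sine is
     completed to its Taylor remainder. *)
  transitivity (base_value x + 2^-1 * (\sum_(z <- s) weight z * ph z x ^+ 2)
     - \sum_(z <- s) weight z + trig_grad x k0 (F k0)); first by rewrite w0 g0 subr0 addr0.
  rewrite /base_value horner_trig_poly /trig_grad mulr_sumr -big_split -!sumrB -big_split.
  apply: eq_bigr => z _; rewrite /C /S /weight dotpDr cosD /=; by field.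
split=> [|sin0].
  apply: (@ord_eq _ _ _ (fun x => \sum_(z <- s) C z x - \sum_(z <- s) S z x)).
    by move=> x; rewrite E.

  apply: ordD; first by apply: ord_le oC.
  apply: ordN; apply: ord_sum => z _; apply: ordZ.
  apply: (@ord_comp _ _ 1 3 _ (fun t => sin t - t) 1) => //.
    by move=> t; rewrite mul1r sin_taylor.
  exact: ord_ph.
apply: (@ord_eq _ _ _ (fun x => \sum_(z <- s) C z x)) => // x.
rewrite E [X in _ - X]big_seq_cond [X in _ - X]big1 ?subr0 // => z /andP[zs _].
by rewrite /S sin0 // mulr0 mul0r.
Qed.

Lemma ord_quad : ord 2 (fun x => \sum_(z <- s) weight z * ph z x ^+ 2).
Proof.
apply: ord_sum => z _; apply: ordZ.
apply: (@ord_eq _ _ _ (fun x => ph z x * ph z x)) => [x|]; first by rewrite expr2.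
exact: (ordM (ord_ph z) (ord_ph z)).
Qed.

Lemma shift_cvg : k0 + x @[x --> (0 : 'rV[R]_n)] --> k0.
Proof.
rewrite -[X in _ --> X]addr0.
apply: (@cvgD R 'rV[R]_n 'rV[R]_n (nbhs (0 : 'rV[R]_n)) _ (fun=> k0) id k0 0).
  exact: cvg_cst.
exact: cvg_id.
Qed.

(** Write [eta * w = - base_value], where [w] tends to [dtrig k0]. A first bound [eta = O(|x|^2)] is
    fed back: replacing [w] by its limit costs [eta * (w - dtrig k0)], of order 3, or 4 when the
    sines vanish. *)
Lemma band_local_expansion :
  ord 3 (fun x => F (k0 + x) - F k0 - 2^-1 * (x *m Hess F k0 *m x^T) 0 0) /\
  ((forall z, z \in s -> sin (ph z k0) = 0) ->
   ord 4 (fun x => F (k0 + x) - F k0 - 2^-1 * (x *m Hess F k0 *m x^T) 0 0)).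
Proof.
pose eta (x : 'rV[R]_n) := F (k0 + x) - F k0.
pose q x := \sum_(z <- s) weight z * ph z x ^+ 2.
pose w (x : 'rV[R]_n) := trig_quot k0 (k0 + x).
have d0 : dtrig k0 != 0 := simpleF.
have wE x : eta x * w x = - base_value x by exact: root_increment.
have wcvg : w x @[x --> (0 : 'rV[R]_n)] --> dtrig k0.
  rewrite -trig_quot_diag; apply: (cvg_comp (fun x => k0 + x) (trig_quot k0) shift_cvg).
  exact: trig_quot_continuous.
have [b3 b4] := base_value_expansion.
have ob : ord 2 base_value.
  apply: (@ord_eq _ _ _ (fun x => (base_value x + 2^-1 * q x) + (- 2^-1) * q x)).
    by move=> x; ring.
  by apply: ordD; [exact: (@ord_le _ _ 3)|apply: ordZ; exact: ord_quad].
have oeta : ord 2 eta.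
  apply: (@ord_near _ _ _ (fun x => (w x)^-1 * - base_value x)).
    near=> x; have w0 : w x != 0 by near: x; exact: (cvgr_neq0 _ wcvg).
    by rewrite -wE mulrCA mulVf ?mulr1.
  apply: (@ordM _ _ 0 2); last exact: ordN.
  by apply: (@ord_cvg _ _ _ (dtrig k0)^-1); exact: (cvgV d0 wcvg).
(* An order [m] for [w - dtrig k0] is worth order [2 + m] for [F], since [eta] already has order
   2. *)
have key m : ord m (fun x => w x - dtrig k0) ->
   ord (2 + m) (fun x => base_value x + 2^-1 * q x) ->
   ord (2 + m) (fun x => F (k0 + x) - F k0 - 2^-1 * (x *m Hess F k0 *m x^T) 0 0).
  move=> ow ob'.
  apply: (@ord_eq _ _ _ (fun x => - (dtrig k0)^-1 *
     (eta x * (w x - dtrig k0) + (base_value x + 2^-1 * q x)))).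
    move=> x; rewrite mulrBr wE Hess_form -/(q x) -/(eta x); field.
    by rewrite d0.
  by apply: ordZ; apply: ordD => //; exact: ordM.
pose u1 z x := cos (ph z (k0 + x)) * (diff_quot (diff_quot z.1 (F k0)) (F k0)).[F (k0 + x)].
pose u2 z x := (diff_quot z.1 (F k0)).[F k0] * (cos (ph z k0) * (cos (ph z x) - 1)).
pose u3 z x := (diff_quot z.1 (F k0)).[F k0] * sin (ph z k0) * sin (ph z x).
(* Three sources of variation: [u1] from the spectral value, of order 2 thanks to [eta]; [u2] from
   the cosines, of order 2; [u3] from the sines, the only first-order part. *)
have wE2 x : w x - dtrig k0 = eta x * (\sum_(z <- s) u1 z x)
    + \sum_(z <- s) u2 z x - \sum_(z <- s) u3 z x.
  rewrite -trig_quot_diag /w /trig_quot mulr_sumr -!sumrB -big_split -sumrB /=.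
  apply: eq_bigr => z _; rewrite /u1 /u2 /u3.
  have := horner_diff_quot (diff_quot z.1 (F k0)) (F k0) (F (k0 + x)).
  move=> /(canRL (subrK _)) ->; rewrite -/(eta x) dotpDr cosD; ring.
have o1 : ord 2 (fun x => eta x * (\sum_(z <- s) u1 z x)).
  apply: (@ordM _ _ 2 0) => //; apply: (ord_cvg (l := \sum_(z <- s) u1 z 0)).
  apply: (@cvg_sumr R _ (nbhs (0 : 'rV[R]_n)) _ _ _ u1) => z.
  rewrite /u1 addr0; apply: cvgM.
    apply: (cvg_comp (fun x => k0 + x) (fun k => cos (ph z k)) shift_cvg).
    exact: cos_ph_continuous.
  apply: (cvg_comp (fun x => k0 + x) (fun k => _.[F k]) shift_cvg).
  exact: hornerF_continuous.
have o2 : ord 2 (fun x => \sum_(z <- s) u2 z x).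
  apply: ord_sum => z _; apply: ordZ; apply: ordZ.
  apply: (@ord_eq _ _ _ (fun x => (cos (ph z x) - 1 + ph z x ^+ 2 / 2)
     + (- 2^-1) * (ph z x * ph z x))); first by move=> x; field.
  apply: ordD; last by apply: ordZ; exact: (ordM (ord_ph z) (ord_ph z)).
  apply: (@ord_le _ _ 4) => //.
  apply: (@ord_comp _ _ 1 4 _ (fun t => cos t - 1 + t ^+ 2 / 2) 1) => //.
    by move=> t; rewrite mul1r cos_taylor.
  exact: ord_ph.
have o12 : ord 2 (fun x => eta x * (\sum_(z <- s) u1 z x) + \sum_(z <- s) u2 z x).
  exact: ordD.
split=> [|sin0].
  apply: (key 1) => //.
  apply: (@ord_eq _ _ _ (fun x => (eta x * (\sum_(z <- s) u1 z x)
    + \sum_(z <- s) u2 z x) - \sum_(z <- s) u3 z x)).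
    by move=> x; rewrite wE2.
  apply: ordD; first exact: (@ord_le _ _ 2).
  apply: ordN; apply: ord_sum => z _; apply: ordZ.
  apply: (@ord_eq _ _ _ (fun x => (sin (ph z x) - ph z x) + ph z x)).
    by move=> x; rewrite subrK.
  apply: ordD; last exact: ord_ph.
  apply: (@ord_le _ _ 3) => //.
  apply: (@ord_comp _ _ 1 3 _ (fun t => sin t - t) 1) => //.
    by move=> t; rewrite mul1r sin_taylor.
  exact: ord_ph.
apply: (key 2); last exact: b4.
apply: (@ord_eq _ _ _ (fun x => (eta x * (\sum_(z <- s) u1 z x)
    + \sum_(z <- s) u2 z x))) => // x.
rewrite wE2 [X in _ - X]big_seq_cond [X in _ - X]big1 ?subr0 // => z /andP[zs _].
by rewrite /u3 sin0 // mulr0 mul0r.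
Unshelve. all: by end_near. Qed.

End LocalExpansion.

(** * Minimum over a family of hyperplanes *)

Section Enorm.
Variables (R : realType).
Implicit Types n : nat.

Lemma dotp_ge0 n (x : 'rV[R]_n) : 0 <= dotp x x.
Proof. by apply: sumr_ge0 => i _; rewrite -expr2 sqr_ge0. Qed.

Lemma enorm_ge0 n (x : 'rV[R]_n) : 0 <= enorm x.
Proof. exact: sqrtr_ge0. Qed.

Lemma sqr_enorm n (x : 'rV[R]_n) : enorm x ^+ 2 = dotp x x.
Proof. by rewrite sqr_sqrtr // dotp_ge0. Qed.

Lemma coord_le_enorm n (x : 'rV[R]_n) i : `|x 0 i| <= enorm x.
Proof.
rewrite -sqrtr_sqr ler_sqrt ?dotp_ge0 // /dotp (bigD1 i) //= -expr2 lerDl.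
by apply: sumr_ge0 => j _; rewrite -expr2 sqr_ge0.
Qed.

Lemma norm_le_enorm n (x : 'rV[R]_n) : `|x| <= enorm x.
Proof.
have -> : `|x| = mx_norm x by [].
rewrite mx_normrE; apply: bigmax_le; first exact: enorm_ge0.
by move=> [i j] _ /=; rewrite ord1 coord_le_enorm.
Qed.

Lemma enorm_le_norm n (x : 'rV[R]_n) : enorm x <= n%:R * `|x|.
Proof.
rewrite -(@ler_pXn2r _ 2) ?nnegrE ?enorm_ge0 ?mulr_ge0 // sqr_enorm exprMn.
have h : dotp x x <= n%:R * `|x| ^+ 2.
  rewrite /dotp mulr_natl -[X in _ *+ X]card_ord -sumr_const; apply: ler_sum => i _.
  rewrite -expr2 -real_normK ?num_real // lerXn2r ?nnegrE //.
  exact: coord_le_norm.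
apply: le_trans h _; rewrite ler_wpM2r ?exprn_ge0 //.
by rewrite -natrX ler_nat; case: (n) => // k; rewrite expnS expn1 leq_pmulr.
Qed.

Lemma enorm_eq0 n (x : 'rV[R]_n) : enorm x = 0 -> x = 0.
Proof. by move=> h; apply/eqP; rewrite -normr_le0 -h norm_le_enorm. Qed.

Lemma dotp_cauchy n (x y : 'rV[R]_n) : `|dotp x y| <= enorm x * enorm y.
Proof.
rewrite -(@ler_pXn2r _ 2) ?nnegrE ?mulr_ge0 ?enorm_ge0 // exprMn !sqr_enorm.
rewrite real_normK ?num_real //.
have [y0|y0] := eqVneq (dotp y y) 0.
  have -> : y = 0 by apply: enorm_eq0; rewrite /enorm y0 sqrtr0.
  by rewrite !dotp0r expr0n mulr0.
have := dotp_ge0 (dotp y y *: x - dotp x y *: y).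
have -> : dotp (dotp y y *: x - dotp x y *: y) (dotp y y *: x - dotp x y *: y) =
   dotp y y * (dotp x x * dotp y y - dotp x y ^+ 2).
  rewrite dotpDr dotpNr !dotpZr ![dotp (_ - _) _]dotpC !(dotpDr, dotpNr, dotpZr).
  by rewrite [dotp y x]dotpC; ring.
by rewrite pmulr_rge0 ?subr_ge0 // lt_neqAle eq_sym y0 dotp_ge0.
Qed.

(** Cauchy-Schwarz on each column; the added 1 keeps [K] positive even for the zero matrix, so that
    inequalities can be divided by it. *)
Lemma enorm_mulmx_bounded n (M : 'M[R]_n) :
  exists2 K, 0 < K & forall x : 'rV[R]_n, enorm (x *m M) <= K * enorm x.
Proof.
exists (1 + \sum_j enorm (row j M^T)) => [|x].
  by rewrite ltr_wpDr ?ltr01 // sumr_ge0 // => j _; exact: enorm_ge0.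
have S0 : 0 <= \sum_j enorm (row j M^T) by rewrite sumr_ge0 // => j _; exact: enorm_ge0.
apply: (@le_trans _ _ ((\sum_j enorm (row j M^T)) * enorm x)); last first.
  by rewrite ler_wpM2r ?enorm_ge0 // lerDr ler01.
rewrite -(@ler_pXn2r _ 2) ?nnegrE ?mulr_ge0 ?enorm_ge0 // sqr_enorm exprMn.
have : dotp (x *m M) (x *m M) <= \sum_j (enorm (row j M^T)) ^+ 2 * enorm x ^+ 2.
  apply: ler_sum => j _; rewrite -expr2 -exprMn -real_normK ?num_real //.
  rewrite lerXn2r ?nnegrE ?mulr_ge0 ?enorm_ge0 // mulrC.
  have -> : (x *m M) 0 j = dotp x (row j M^T) 
    by rewrite mxE; apply: eq_bigr => i _; rewrite !mxE.
  exact: dotp_cauchy.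
move=> /le_trans; apply; rewrite -mulr_suml ler_wpM2r ?sqr_ge0 //.
suff /andP[] : (\sum_j enorm (row j M^T) ^+ 2 <= (\sum_j enorm (row j M^T)) ^+ 2) &&
  (0 <= \sum_j enorm (row j M^T)) by [].
elim/big_rec2: _ => [|j a b _ /andP[ab a0]]; first by rewrite expr0n lexx.
have := enorm_ge0 (row j M^T); move: (enorm _) => e e0.
by apply/andP; split; nra.
Qed.

Lemma alpha_le_half (x : R) : `|alpha x| <= 2^-1.
Proof.
rewrite /alpha; have := ceil_itv (x - 2^-1).
move: (Num.ceil _) => c; rewrite intrD /= => /andP[h1 h2].
by rewrite ler_norml; apply/andP; split; lra.
Qed.

Lemma alpha_min (x : R) (N : int) : `|alpha x| <= `|x - N%:~R|.
Proof.
have := alpha_le_half x; rewrite /alpha; have := ceil_itv (x - 2^-1).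
move: (Num.ceil _) => c; rewrite intrD /= => /andP[h1 h2] h3.
have [Nc|cN|-> //] := ltgtP N c.
  have : N%:~R <= c%:~R - 1 :> R by rewrite -[1]/(1%:~R) -intrB ler_int; lia.
  move=> h; apply: le_trans h3 _; rewrite ler_normr; apply/orP; left; lra.
have : c%:~R + 1 <= N%:~R :> R by rewrite -[1]/(1%:~R) -intrD ler_int; lia.
by move=> h; apply: le_trans h3 _; rewrite ler_normr; apply/orP; right; lra.
Qed.

End Enorm.

(** A ceiling rather than a floor, because the torus [(-pi, pi]] is closed on the right. *)
Lemma torus_shift (R : realType) (n : nat) (p : 'rV[R]_n) :
  exists m : 'rV[int]_n, torus (p + (2 * pi) *: toR R m).
Proof.
exists (\row_i - Num.ceil ((p 0 i - pi) / (2 * pi))) => i; rewrite !mxE.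
have := ceil_itv ((p 0 i - pi) / (2 * pi)); move: (Num.ceil _) => c.
have pi0 : 0 < 2 * pi :> R by rewrite mulr_gt0 // pi_gt0.
rewrite intrD /= ltr_pdivlMr // ler_pdivrMr // => /andP[h1 h2].
by rewrite mulrNz; apply/andP; split; lra.
Qed.

(** * A nonnegative periodic even function with a nondegenerate zero, minimized under an integrality
    constraint *)

Section Asymptotics.
Variables (R : realType) (n : nat) (G : 'rV[R]_n -> R) (k0 : 'rV[R]_n).
Variables (S : 'M[R]_n) (q : nat).
Hypothesis contG : continuous G.
Hypothesis G_ge0 : forall p, 0 <= G p.
Hypothesis evenG : forall p, G (- p) = G p.
Hypothesis perG : forall p (m : 'rV[int]_n), G (p + (2 * pi) *: toR R m) = G p.
Hypothesis zeroG : forall p, torus p -> G p = 0 ->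
  exists m : 'rV[int]_n, p = k0 + (2 * pi) *: toR R m \/ p = - k0 + (2 * pi) *: toR R m.
Hypothesis posS : posdef S.
Hypothesis q_ge3 : (2 < q)%N.
Hypothesis expandG : ord q (fun x => G (k0 + x) - 2^-1 * enorm (x *m S) ^+ 2).

(** The second case reads [- (k0 + x)] rather than [- k0 + x], so that evenness and periodicity give
    the value [G (k0 + x)] in both cases. *)
Definition near_zero (delta : R) (p : 'rV[R]_n) := exists x, exists m : 'rV[int]_n,
  `|x| < delta /\ (p = k0 + x + (2 * pi) *: toR R m \/
                   p = - (k0 + x) + (2 * pi) *: toR R m).

Lemma near_zero_shift delta p m : near_zero delta (p + (2 * pi) *: toR R m) ->
  near_zero delta p.
Proof.
move=> [x [m' [xd h]]]; exists x, (m' - m); split => //.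
have -> : toR R (m' - m) = toR R m' - toR R m by rewrite /toR map_mxB.
by rewrite scalerBr !addrA; case: h => /(canRL (addrK _)) ->; [left|right].
Qed.

(** Compactness of the closed cube [K]: near a zero of [G] all points qualify, and near any other
    point [G] stays above some [e]. Periodicity carries the result to the whole space. *)
Lemma small_near_zero delta : 0 < delta ->
  exists2 e, 0 < e & forall p, G p < e -> near_zero delta p.
Proof.
move=> d0; pose K := [set v : 'rV[R]_n | forall i, `[- pi, pi]%classic (v 0 i)].
have cK : compact K 
  by apply: (@rV_compact R n (fun=> `[- pi, pi]%classic)) => i; exact: segment_compact.
have : \forall e \near (0 : R)^'+, K `<=` [set p | G p < e -> near_zero delta p].
  apply: ((compact_near_coveringP K).1 cK _ _ (fun e p => G p < e -> near_zero delta p)).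
  move=> p Kp; have [Gp|Gp] := eqVneq (G p) 0.
    have [m tm] := torus_shift p.
    have [m' hm'] := zeroG tm (etrans (perG p m) Gp).
    near=> y e => _; apply: (@near_zero_shift _ _ m).
    have yd : `|y - p| < delta.
      have : ball p delta y by near: y; exact: nbhsx_ballx.
      by rewrite -ball_normE /= distrC.
    case: hm' => hm'; [exists (y - p), m'|exists (p - y), m'].
      by split=> //; left; rewrite addrAC -hm' [RHS]addrC addrA subrK.
    split; first by rewrite distrC.
    by right; rewrite opprD opprB addrAC -hm' [RHS]addrC addrA subrK.
  have Gp0 : 0 < G p by rewrite lt_neqAle eq_sym Gp G_ge0.
  (* Vacuous here: such a [y] has [G y > G p / 2 > e]. *)
  exists ([set y | `|G p - G y| < G p / 2], [set e | e < G p / 2]).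
    split; first by have := @contG p; move/cvgrPdist_lt; apply; rewrite divr_gt0.
    by apply: nbhs_right_lt; rewrite divr_gt0.
  move=> [y e] [/= hy he] Gye; move: hy; rewrite ltr_norml => /andP[_].
  lra.
move=> h; have [e [he e0]] := filter_ex (filterI h (nbhs_right_gt (0 : R))).
exists e => // p Gp; have [m tm] := torus_shift p.
apply: (@near_zero_shift _ _ m); apply: he; last by rewrite perG.
by move=> i /=; rewrite in_itv /=; have /andP[/ltW -> ->] := tm i.
Unshelve. all: by end_near. Qed.

(** The second bound makes the remainder at most half of the quadratic part, so [G (k0 + x)] is at
    least a quarter of [enorm (x *m S) ^ 2]. This later confines nearly minimal points to size
    [O(1 / |t|)]. *)
Lemma local_model : exists C, exists delta, [/\ 0 <= C, 0 < delta &
  forall x, `|x| < delta ->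
    `|G (k0 + x) - 2^-1 * enorm (x *m S) ^+ 2| <= C * enorm (x *m S) ^+ q /\
    C * enorm (x *m S) ^+ q <= 4^-1 * enorm (x *m S) ^+ 2].
Proof.
have Su := posdef_unitmx posS.
have [K1 K10 hK1] := enorm_mulmx_bounded (invmx S).
have [K2 K20 hK2] := enorm_mulmx_bounded S.
have [C0 /nbhs_norm0P[d0 /= d0p hd0]] := expandG.
pose C := `|C0| * K1 ^+ q.
have C0p : 0 <= C by rewrite mulr_ge0 // exprn_ge0 // ltW.
(* For [|x| < 1 / D] this forces [y * (1 + 4 * C) <= 1], hence both [y <= 1] and [C * y <= 1/4]. The
   successor keeps [D] positive in dimension 0. *)
pose D := K2 * n.+1%:R * (1 + 4 * C).
have D0 : 0 < D by rewrite !mulr_gt0 ?ltr0n //; lra.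
exists C, (Num.min d0 D^-1); split=> //.
  by rewrite lt_min d0p invr_gt0.
move=> x; rewrite lt_min => /andP[xd0 xD]; set y := enorm (x *m S).
have y0 : 0 <= y by exact: enorm_ge0.
have xy : `|x| <= K1 * y.
  by apply: le_trans (norm_le_enorm x) _; rewrite -{1}[x](mulmxK Su); exact: hK1.
split.
  apply: le_trans (hd0 x xd0) _; apply: (@le_trans _ _ (`|C0| * `|x| ^+ q)).
    by rewrite ler_wpM2r ?exprn_ge0 ?ler_norm.
  by rewrite /C -mulrA -exprMn ler_wpM2l // lerXn2r ?nnegrE // mulr_ge0 // ltW.
have yD : y * (1 + 4 * C) <= 1.
  have h : y <= K2 * n.+1%:R * `|x|.
    apply: le_trans (hK2 x) _; rewrite -mulrA ler_pM2l //.
    apply: le_trans (enorm_le_norm x) _; rewrite ler_wpM2r // ler_nat //.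
  have : D * `|x| <= 1 by rewrite -ler_pdivlMl // mulr1 ltW.
  apply: le_trans; rewrite /D mulrAC; apply: ler_wpM2r => //; lra.
have y1 : y <= 1 by nra.
have Cy : C * y <= 4^-1 by nra.
have -> : y ^+ q = y ^+ (q - 3) * y * y ^+ 2.
  by rewrite -exprSr -exprD; congr (_ ^+ _); rewrite addSn -addnS subnK.
rewrite mulrA; apply: ler_wpM2r; first by rewrite exprn_ge0.
have : y ^+ (q - 3) <= 1 by rewrite exprn_ile1.
have : 0 <= y ^+ (q - 3) by rewrite exprn_ge0.
have : 0 <= C * y by rewrite mulr_ge0.
nra.
Qed.

(* In the coordinates [y = x S], and with [w = tt S^-1], the model is [|y|^2 / 2] on
   the hyperplanes [<w, y> = - 2 pi rho + 2 pi N]; on the closest one to the origin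
   the minimum is attained at a multiple of [w]. *)
Lemma constrained_minimum : exists C, exists M, 0 <= C /\
  forall tt : 'rV[int]_n, M <= enorm (toR R tt) ->
  let E := 2 * pi ^+ 2 * alpha (dotp (toR R tt) k0 / (2 * pi)) ^+ 2 /
           enorm (toR R tt *m invmx S) ^+ 2 in
  (exists p, exists N : int, dotp (toR R tt) p = 2 * pi * N%:~R /\
     G p <= E + C / enorm (toR R tt) ^+ q) /\
  (forall p (N : int), dotp (toR R tt) p = 2 * pi * N%:~R ->
     E - C / enorm (toR R tt) ^+ q <= G p).
Proof.
have Su := posdef_unitmx posS.
have [K1 K10 hK1] := enorm_mulmx_bounded (invmx S).
have [K2 K20 hK2] := enorm_mulmx_bounded S.
have [C [delta [C0 d0 hloc]]] := local_model.
have [e e0 he] := small_near_zero d0.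
have pi0 : 0 < pi :> R := pi_gt0 R.
have pin0 : pi != 0 :> R by rewrite gt_eqF.
(* Three demands on [om]: it is at least 1, the explicit minimizer lies within [delta] of [k0], and
   [E] lies below the compactness threshold [e]. *)
pose M0 : R := 1 + K1 * pi / delta + pi ^+ 2 / e.
(* Relevant points satisfy [y <= 2 * pi / om], and [enorm T <= K2 * om] converts [om] into the norm
   of [T]. *)
exists (C * (2 * pi * K2) ^+ q), (K2 * M0); split.
  by rewrite mulr_ge0 // exprn_ge0 // !mulr_ge0 // ltW.
move=> tt; set T := toR R tt; set al := alpha _; set w := T *m invmx S => hT.
set om := enorm w; move=> E.
have omT : enorm T <= K2 * om by rewrite -{1}[T](mulmxKV Su); exact: hK2.
have omM : M0 <= om by rewrite -(ler_pM2l K20) (le_trans hT).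
have a1 : 0 <= K1 * pi / delta by rewrite !mulr_ge0 ?invr_ge0 // ltW.
have a2 : 0 <= pi ^+ 2 / e by rewrite !mulr_ge0 ?invr_ge0 ?exprn_ge0 // ltW.
have om1 : 1 <= om by move: omM; rewrite /M0; lra.
have om0 : 0 < om by lra.
have omd : K1 * pi / om < delta.
  by rewrite ltr_pdivrMr // [delta * _]mulrC -ltr_pdivrMr //; move: omM; rewrite /M0; lra.
have ome : pi ^+ 2 / om ^+ 2 < e.
  rewrite ltr_pdivrMr ?exprn_gt0 // [e * _]mulrC -ltr_pdivrMr //.
  by move: omM; rewrite /M0; nra.
have T0 : 0 < enorm T.
  apply: lt_le_trans hT; rewrite mulr_gt0 //; rewrite /M0; lra.
have err : C * (2 * pi / om) ^+ q <= C * (2 * pi * K2) ^+ q / enorm T ^+ q.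
  rewrite -[X in _ <= X]mulrA ler_wpM2l // -exprVn -exprMn lerXn2r ?nnegrE //.
  - by rewrite !mulr_ge0 ?invr_ge0 // ltW.
  - by rewrite !mulr_ge0 ?invr_ge0 // ltW.
  - rewrite ler_pdivrMr // mulrAC ler_pdivlMr // -!mulrA !ler_pM2l //.
have alh : `|al| <= 2^-1 by exact: alpha_le_half.
have al2 : al ^+ 2 <= 4^-1.
  by rewrite -real_normK ?num_real //; have := normr_ge0 al; nra.
have E0 : 0 <= E.
  rewrite /E; apply: mulr_ge0; last by rewrite invr_ge0 sqr_ge0.
  by apply: mulr_ge0; rewrite ?sqr_ge0 // mulr_ge0 ?sqr_ge0.
have Ele : E <= pi ^+ 2 / om ^+ 2.
  rewrite /E ler_wpM2r ?invr_ge0 ?exprn_ge0 ?(ltW om0) //.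
  by have := sqr_ge0 (pi : R); nra.
have dotT x : dotp T x = dotp w (x *m S).
  rewrite !dotpE trmx_mul; case: posS => -> _.
  by rewrite mulmxA mulmxKV.
split.
  (* In the coordinates [x S] this is the multiple of [w] whose product with [w] is [- 2 pi al], the
     foot of the perpendicular on the nearest hyperplane. *)
  pose x := (- (2 * pi * al) / om ^+ 2) *: (w *m invmx S).
  have xS : x *m S = (- (2 * pi * al) / om ^+ 2) *: w.
    by rewrite -scalemxAl mulmxKV.
  have ny : enorm (x *m S) = 2 * pi * `|al| / om.
    rewrite xS /enorm dotpZr dotpC dotpZr mulrA -expr2 sqrtrM ?sqr_ge0 //.
    rewrite sqrtr_sqr -/(enorm w) -/om normrM normrN normrM.
    rewrite normrV ?unitfE ?expf_neq0 ?gt_eqF //.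
    rewrite (ger0_norm (ltW (exprn_gt0 _ om0))).
    rewrite (ger0_norm (_ : 0 <= 2 * pi)) ?mulr_ge0 ?(ltW pi0) //.
    by field; rewrite gt_eqF.
  have nyle : enorm (x *m S) <= pi / om.
    by rewrite ny ler_wpM2r ?invr_ge0 ?(ltW om0) //; nra.
  have xd : `|x| < delta.
    apply: le_lt_trans (norm_le_enorm x) _; rewrite -[x](mulmxK Su).
    apply: le_lt_trans (hK1 _) _; apply: le_lt_trans _ omd.
    by rewrite -mulrA ler_pM2l.
  have [h1 _] := hloc x xd.
  exists (k0 + x), (Num.ceil (dotp T k0 / (2 * pi) - 2^-1)); split.
    rewrite dotpDr [X in _ + X]dotT xS dotpZr -sqr_enorm -/om.
    rewrite /al /alpha -/T; move: (Num.ceil _) => c.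
    by move: (pi : R) pin0 => P P0; field; rewrite P0 gt_eqF.
  have : C * enorm (x *m S) ^+ q <= C * (2 * pi / om) ^+ q.
    rewrite ler_wpM2l // lerXn2r ?nnegrE ?enorm_ge0 ?mulr_ge0 ?invr_ge0
      ?(ltW pi0) ?(ltW om0) //.
    apply: le_trans nyle _; rewrite ler_wpM2r ?invr_ge0 ?(ltW om0) //; lra.
  move: h1; rewrite ler_norml => /andP[_ h1] h2.
  have -> : E = 2^-1 * enorm (x *m S) ^+ 2.
    by rewrite ny !exprMn real_normK ?num_real // /E exprVn; move: (pi : R) => P; lra.
  lra.
move=> p N hN; apply: le_trans (_ : E - C * (2 * pi / om) ^+ q <= _).
  by rewrite lerD2l lerN2.
have [Gp|Gp] := leP E (G p).
  apply: le_trans Gp; rewrite gerBl mulr_ge0 // exprn_ge0 //.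
  by rewrite !mulr_ge0 ?invr_ge0 // ltW.
have [x [m [xd hp]]] := he p (lt_trans Gp (le_lt_trans Ele ome)).
(* A translation by [2 pi m] shifts the integer in the constraint and a reflection negates it, so
   [p] may be replaced by [k0 + x]. *)
have [Gx [N' hN']] : G p = G (k0 + x) /\ exists N' : int, dotp T (k0 + x) = 2 * pi * N'%:~R.
  have dm : dotp T (toR R m) = (\sum_i tt 0 i * m 0 i)%:~R.
    by rewrite rmorph_sum; apply: eq_bigr => i _; rewrite !mxE rmorphM.
  case: hp => hp; rewrite hp perG ?evenG; split => //.
    exists (N - \sum_i tt 0 i * m 0 i); rewrite intrB mulrBr -hN hp [RHS]addrC.
    by rewrite !dotpDr dotpZr dm; ring.
  exists (- N + \sum_i tt 0 i * m 0 i); rewrite intrD intrN mulrDr mulrN -hN hp.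
  by rewrite !(dotpDr, dotpNr, dotpZr) dm; ring.
rewrite Gx; have [h1 h2] := hloc x xd.
move: h1 h2; set y := enorm (x *m S) => h1 h2.
have y0 : 0 <= y by exact: enorm_ge0.
(* Cauchy-Schwarz, [N'] being no closer to [<T, k0> / (2 pi)] than the nearest integer. *)
have ywal : 2 * pi * `|al| <= om * y.
  apply: le_trans (dotp_cauchy w (x *m S)); rewrite -dotT.
  have -> : dotp T x = - (2 * pi * (dotp T k0 / (2 * pi) - N'%:~R)).
    have -> : dotp T x = dotp T (k0 + x) - dotp T k0 by rewrite dotpDr addrC addKr.
    by rewrite hN'; move: (pi : R) pin0 => P P0; field.
  rewrite normrN normrM ger0_norm ?mulr_ge0 ?(ltW pi0) //.
  by rewrite ler_pM2l ?mulr_gt0 // alpha_min.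
have Ey : E <= 2^-1 * y ^+ 2.
  rewrite /E ler_pdivrMr ?exprn_gt0 // -/om -[al ^+ 2]real_normK ?num_real //.
  have : 0 <= 2 * pi * `|al| by rewrite !mulr_ge0 ?(ltW pi0).
  move: ywal; rewrite -(_ : (om * y) ^+ 2 / 2 = 2^-1 * y ^+ 2 * om ^+ 2); last by field.
  move=> g1 g2; have : (2 * pi * `|al|) ^+ 2 <= (om * y) ^+ 2.
    by rewrite lerXn2r // nnegrE // (le_trans g2).
  by rewrite !exprMn; lra.
(* From [y ^ 2 / 4 <= G (k0 + x) < E <= pi ^ 2 / om ^ 2]: the point is small because its value is
   below [E]. *)
have yle : y <= 2 * pi / om.
  have Gy : 4^-1 * y ^+ 2 <= E.
    move: h1; rewrite ler_norml => /andP[h1 _]; rewrite Gx in Gp; lra.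
  rewrite -(@ler_pXn2r _ 2) // ?nnegrE ?mulr_ge0 ?invr_ge0 ?(ltW pi0) ?(ltW om0) //.
  rewrite !exprMn exprVn; move: (le_trans Gy Ele); lra.
have : C * y ^+ q <= C * (2 * pi / om) ^+ q.
  by rewrite ler_wpM2l // lerXn2r ?nnegrE // (le_trans y0).
move: h1; rewrite ler_norml => /andP[h1 _]; lra.
Qed.

End Asymptotics.

(** * Trigonometric families of Hermitian matrices *)

Section TrigFamily.
Local Open Scope sesquilinear_scope.
Local Open Scope complex_scope.
Variable R : realType.
Local Notation C := R[i].

Lemma expiD (x y : R) : expi (x + y) = expi x * expi y.
Proof. by rewrite /expi cosD sinD; congr (_ +i* _); rewrite addrC. Qed.

Lemma expi0 : expi (0 : R) = 1.
Proof. by rewrite /expi cos0 sin0. Qed.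

Lemma expiN (x : R) : expi (- x) = (expi x)^*%C.
Proof. by rewrite /expi cosN sinN. Qed.

Lemma sin_int_pi (N : int) : sin (N%:~R * pi : R) = 0.
Proof.
have h (m : nat) : sin (m%:R * pi : R) = 0.
  elim: m => [|m IH]; first by rewrite mul0r sin0.
  by rewrite -natr1 mulrDl mul1r sinD IH sinpi mul0r mulr0 addr0.
by case: N => m; rewrite ?NegzE ?mulrNz ?mulNr ?sinN -pmulrn h ?oppr0.
Qed.

Lemma expi_int (N : int) : expi (2 * pi * N%:~R) = 1 :> C.
Proof.
have h (m : nat) : expi (2 * pi * m%:R) = 1 :> C.
  elim: m => [|m IH]; first by rewrite mulr0 expi0.
  rewrite -[m.+1%:R]natr1 mulrDr mulr1 expiD IH mul1r mulr_natl.
  by rewrite /expi cos2pi sin2pi.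
by case: N => m; rewrite ?NegzE ?mulrNz ?mulrN ?expiN -pmulrn h // conjc1.
Qed.

Lemma dotp_toR (n : nat) (t m : 'rV[int]_n) :
  dotp (toR R t) (toR R m) = (\sum_i t 0 i * m 0 i)%:~R.
Proof. by rewrite rmorph_sum; apply: eq_bigr => i _; rewrite !mxE rmorphM. Qed.

Lemma toRD (n : nat) (t m : 'rV[int]_n) : toR R (t + m) = toR R t + toR R m.
Proof. by rewrite /toR map_mxD. Qed.

Variable n : nat.
Implicit Types (k : 'rV[R]_n).

(** Coefficients are real, so that conjugation amounts to [k -> - k]. *)
Definition trig_sum (s : seq (R * 'rV[int]_n)) k : C :=
  \sum_(z <- s) (z.1)%:C * expi (dotp (toR R z.2) k).

Lemma trig_sumN s k : trig_sum s (- k) = (trig_sum s k)^*%C.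
Proof.
rewrite /trig_sum rmorph_sum; apply: eq_bigr => z _.
by rewrite rmorphM dotpNr expiN; congr (_ * _); exact: esym (conjc_real _).
Qed.

Lemma trig_sum_periodic s k m : trig_sum s (k + (2 * pi) *: toR R m) = trig_sum s k.
Proof.
by apply: eq_bigr => z _; rewrite dotpDr dotpZr dotp_toR expiD expi_int mulr1.
Qed.

Lemma norm_complex_le (z : C) : `|z| <= (`|complex.Re z| + `|complex.Im z|)%:C.
Proof.
rewrite {1}[z]complexE; apply: le_trans (ler_normD _ _) _.
rewrite rmorphD; apply: lerD; first by rewrite normc_def /= expr0n addr0 sqrtr_sqr.
by rewrite normrM !normc_def /= !expr0n !add0r !addr0 expr1n sqrtr1 mul1r sqrtr_sqr.
Qed.

(** Stated as the entrywise bound that [weyl_le] takes; the real majorant [b] lets the limit be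
    computed in [R]. *)
Lemma trig_sum_near s k e : 0 < e ->
  \forall k' \near k, `|trig_sum s k' - trig_sum s k| <= e%:C.
Proof.
move=> e0; pose b (z : R * 'rV[int]_n) k' : R :=
  `|z.1| * (`|cos (dotp (toR R z.2) k') - cos (dotp (toR R z.2) k)|
   + `|sin (dotp (toR R z.2) k') - sin (dotp (toR R z.2) k)|).
have bc : \sum_(z <- s) b z k' @[k' --> k] --> \sum_(z <- s) 0.
  apply: (@cvg_sumr R _ (nbhs k) _ _ _ b) => z; rewrite /b.
  rewrite -[X in _ --> X](mulr0 `|z.1|); apply: cvgMl_tmp.
  have d0 (f : 'rV[R]_n -> R) : f k' @[k' --> k] --> f k ->
      `|f k' - f k| @[k' --> k] --> 0.
    move=> fc; have := cvg_norm (cvgB fc (cvg_cst (f k))).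
    by rewrite subrr normr0; apply.
  rewrite -[X in _ --> X](addr0 0); apply: cvgD.
    apply: (d0 (fun k => cos (dotp (toR R z.2) k))).
    by apply: continuous_comp; [exact: dotp_continuous|exact: continuous_cos].
  apply: (d0 (fun k => sin (dotp (toR R z.2) k))).
  by apply: continuous_comp; [exact: dotp_continuous|exact: continuous_sin].
have lb k' : `|trig_sum s k' - trig_sum s k| <= (\sum_(z <- s) b z k')%:C.
  rewrite /trig_sum -sumrB rmorph_sum; apply: le_trans (ler_norm_sum _ _ _) _.
  apply: ler_sum => z _; rewrite -mulrBr normrM /b rmorphM.
  apply: ler_pM => //; last exact: norm_complex_le.
  by rewrite normc_def /= expr0n addr0 sqrtr_sqr.
near=> k'; apply: le_trans (lb k') _; rewrite lecR ltW //.
near: k'; apply: (cvgr_lt _ bc); rewrite big1 //.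
Unshelve. all: by end_near. Qed.

Definition trig_polynomial (f : 'rV[R]_n -> {poly C}) :=
  exists s : seq ({poly R} * 'rV[int]_n), forall k, f k =
   \sum_(z <- s) (expi (dotp (toR R z.2) k))%:P * map_poly (real_complex R) z.1.

Lemma trig_polynomialD f g : trig_polynomial f -> trig_polynomial g ->
  trig_polynomial (fun k => f k + g k).
Proof. by move=> [s hs] [t ht]; exists (s ++ t) => k; rewrite big_cat hs ht. Qed.

Lemma trig_polynomial_real (p : {poly R}) :
  trig_polynomial (fun=> map_poly (real_complex R) p).
Proof.
exists [:: (p, 0)] => k; rewrite big_seq1 /= /toR map_mx0 dotp0l expi0 mul1r //.
Qed.

Lemma trig_polynomialM f g : trig_polynomial f -> trig_polynomial g ->
  trig_polynomial (fun k => f k * g k).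
Proof.
move=> [s hs] [t ht].
exists [seq (z.1 * w.1, z.2 + w.2) | z <- s, w <- t] => k.
rewrite big_allpairs_dep hs ht mulr_suml; apply: eq_bigr => z _.
rewrite mulr_sumr; apply: eq_bigr => w _ /=.
by rewrite toRD dotpDl expiD polyCM rmorphM mulrACA.
Qed.

Lemma trig_polynomial_sum (I : Type) (r : seq I) (P : pred I)
    (f : I -> 'rV[R]_n -> {poly C}) :
  (forall i, trig_polynomial (f i)) ->
  trig_polynomial (fun k => \sum_(i <- r | P i) f i k).
Proof.
move=> h; elim: r => [|i r IH].
  by exists [::] => k; rewrite !big_nil.
have [s hs] : trig_polynomial (fun k => if P i then f i k + \sum_(j <- r | P j) f j k
    else \sum_(j <- r | P j) f j k).
  by case: (P i) => //; exact: trig_polynomialD.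
by exists s => k; rewrite big_cons hs.
Qed.

Lemma trig_polynomial_prod (I : Type) (r : seq I) (f : I -> 'rV[R]_n -> {poly C}) :
  (forall i, trig_polynomial (f i)) ->
  trig_polynomial (fun k => \prod_(i <- r) f i k).
Proof.
move=> h; elim: r => [|i r IH].
  have [s hs] := trig_polynomial_real 1.
  by exists s => k; rewrite big_nil -hs rmorph1.
have [s hs] := trig_polynomialM (h i) IH.
by exists s => k; rewrite big_cons hs.
Qed.

Variables (N : nat) (A : 'rV[R]_n -> 'M[C]_N).
Hypothesis trigA : forall i j, exists s, forall k, A k i j = trig_sum s k.
Hypothesis hermA : forall k, (A k)^t* = A k.

(** Leibniz's formula: the entries of [X - A k] are trigonometric polynomials, a class closed under
    sums and products. *)
Lemma trig_char_poly : trig_polynomial (fun k => char_poly (A k)).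
Proof.
rewrite /char_poly /determinant; apply: trig_polynomial_sum => sg.
apply: trig_polynomialM.
  have [s hs] := trig_polynomial_real ((-1) ^+ sg).
  by exists s => k; rewrite -hs rmorphXn rmorphN1.
apply: trig_polynomial_prod => i.
have [s hs] := trigA i (sg i).
have [u hu] := trig_polynomial_real (if i == sg i then 'X else 0).
exists (u ++ [seq ((- z.1)%:P, z.2) | z <- s]) => k.
rewrite big_cat -hu !mxE hs /trig_sum big_map rmorph_sum -sumrN; congr (_ + _).
  by case: eqP => _; rewrite ?mulr1n ?mulr0n ?map_polyX ?rmorph0.
apply: eq_bigr => z _; rewrite map_polyC /= -polyCM -polyCN; congr _%:P.
by rewrite rmorphN mulrN mulrC.
Qed.

Definition eigenband j k := nth 0 (sorted_eigenvalues (A k)) j.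

Lemma eigenband_periodic j k m : eigenband j (k + (2 * pi) *: toR R m) = eigenband j k.
Proof.
suff e : A (k + (2 * pi) *: toR R m) = A k by rewrite /eigenband e.
apply/matrixP => x y; have [s hs] := trigA x y.
by rewrite !hs trig_sum_periodic.
Qed.

Lemma char_poly_tr (M : 'M[C]_N) : char_poly M^T = char_poly M.
Proof.
rewrite /char_poly -[RHS]det_tr; congr (\det _).
by rewrite /char_poly_mx linearB /= tr_scalar_mx map_trmx.
Qed.

(** Real coefficients make [A (- k)] the conjugate of [A k], which is its transpose as [A k] is
    Hermitian; transposition preserves the characteristic polynomial. *)
Lemma eigenband_even j k : eigenband j (- k) = eigenband j k.
Proof.
rewrite /eigenband /sorted_eigenvalues -[char_poly (A k)]char_poly_tr.
have -> // : A (- k) = (A k)^T.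
apply/matrixP => x y; have [s hs] := trigA x y.
rewrite hs trig_sumN -hs mxE -[in RHS]hermA !mxE //.
Qed.

Lemma eigenband_continuous j : (j < N)%N -> continuous (eigenband j).
Proof.
move=> jN k; apply/(@cvgrPdist_le _ _ _ (nbhs k)) => e e0.
have N0 : 0 < N%:R ^+ 2 :> R by rewrite exprn_gt0 // ltr0n; case: (N) jN.
pose e' := e / N%:R ^+ 2; have e'0 : 0 < e' by rewrite divr_gt0.
have : \forall k' \near k, forall xy : 'I_N * 'I_N, `|A k' xy.1 xy.2 - A k xy.1 xy.2| <= e'%:C.
  apply: (@filter_forall _ _ (fun (xy : 'I_N * 'I_N) k' =>
    `|A k' xy.1 xy.2 - A k xy.1 xy.2| <= e'%:C) (nbhs k)) => xy.
  have [s hs] := trigA xy.1 xy.2.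
  have := trig_sum_near s k e'0; apply: filterS => k'.
  by rewrite !hs.
apply: filterS => k' h.
have h1 : eigenband j k' <= eigenband j k + N%:R ^+ 2 * e'.
  by apply: weyl_le => // x y; exact: (h (x, y)).
have h2 : eigenband j k <= eigenband j k' + N%:R ^+ 2 * e'.
  by apply: weyl_le => // x y; rewrite distrC; exact: (h (x, y)).
have e'E : N%:R ^+ 2 * e' = e by rewrite /e' mulrC divfK // gt_eqF.
move: (eigenband j k) (eigenband j k') h1 h2 => u v; rewrite e'E => h1 h2.
by rewrite ler_distlC; apply/andP; split; lra.
Qed.

(** The eigenvalues being real, the characteristic polynomial equals its real part, and taking real
    parts of the coefficients turns [expi] into [cos]. *)
Lemma trig_poly_eigenband : exists s : seq ({poly R} * 'rV[int]_n),
  forall k, trig_poly s k = \prod_(i < N) ('X - (eigenband i k)%:P).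
Proof.
have [s hs] := trig_char_poly; exists s => k; apply/polyP => l.
have [U [d [_ _ _ dE cM]]] := hermitian_sorted_spectral (hermA k).
have h : char_poly (A k) = map_poly (real_complex R) (\prod_(i < N) ('X - (eigenband i k)%:P)).
  rewrite cM rmorph_prod; apply: eq_bigr => i _.
  by rewrite rmorphB /= map_polyX map_polyC /= /eigenband dE.
have := congr1 (fun p : {poly C} => complex.Re p`_l) (etrans (esym h) (hs k)).
rewrite coef_map /= => ->; rewrite /trig_poly !coef_sum raddf_sum; apply: eq_bigr => z _.
by rewrite coefZ coefCM coef_map /=; case: z => c m /=; rewrite mulr0 subr0.
Qed.

End TrigFamily.

Lemma deriv_prod_XsubC (F : comNzRingType) (I : finType) (f : I -> F) (j : I) :
  (\prod_i ('X - (f i)%:P))^`().[f j] = \prod_(i | i != j) (f j - f i).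
Proof.
rewrite (bigD1 j) //= derivM derivXsubC mul1r hornerD hornerM.
rewrite hornerXsubC subrr mul0r addr0 horner_prod.
by apply: eq_bigr => i _; rewrite hornerXsubC.
Qed.

Section FamilyAsymptotics.
Local Open Scope sesquilinear_scope.
Local Open Scope complex_scope.
Variables (R : realType) (n N : nat) (A : 'rV[R]_n -> 'M[R[i]]_N).
Hypothesis trigA : forall i j, exists s, forall k, A k i j = trig_sum s k.
Hypothesis hermA : forall k, (A k)^t* = A k.
Variables (j : nat) (k0 : 'rV[R]_n) (sigma : R).
Local Notation F := (eigenband A j).
Local Notation H := (sigma *: Hess F k0).
Hypothesis j_lt : (j < N)%N.
Hypothesis sigma_neq0 : sigma != 0.
Hypothesis posH : posdef H.
Hypothesis extrF : forall k, torus k -> 0 <= sigma * (F k - F k0).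
Hypothesis simpleF : forall i, (i < N)%N -> i <> j -> eigenband A i k0 <> F k0.
Hypothesis uniqueF : forall k, torus k -> F k = F k0 ->
  k = k0 \/ exists m : 'rV[int]_n, k = - k0 + (2 * pi) *: toR R m.

Lemma family_constrained_minimum (q : nat) :
  q = 3 \/ (q = 4 /\ forall i, k0 0 i = 0 \/ k0 0 i = pi) ->
  exists C, exists M, 0 <= C /\
  forall tt : 'rV[int]_n, M <= enorm (toR R tt) ->
  let E := 2 * pi ^+ 2 * alpha (dotp (toR R tt) k0 / (2 * pi)) ^+ 2 /
           enorm (toR R tt *m invmx (possqrt H)) ^+ 2 in
  (exists p, exists N : int, dotp (toR R tt) p = 2 * pi * N%:~R /\
     sigma * (F p - F k0) <= E + C / enorm (toR R tt) ^+ q) /\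
  (forall p (N : int), dotp (toR R tt) p = 2 * pi * N%:~R ->
     E - C / enorm (toR R tt) ^+ q <= sigma * (F p - F k0)).
Proof.
move=> hq; have [posS SE] := possqrtP posH.
have contF : continuous F by exact: eigenband_continuous.
have perF k m : F (k + (2 * pi) *: toR R m) = F k by exact: eigenband_periodic.
have extr k : 0 <= sigma * (F k - F k0).
  by have [m tm] := torus_shift k; rewrite -(perF k m) extrF.
have [s hs] := trig_poly_eigenband trigA hermA.
have rootF k : (trig_poly s k).[F k] = 0.
  rewrite hs (bigD1 (Ordinal j_lt)) //= hornerM.
  by rewrite hornerXsubC subrr mul0r.
have simple : (trig_poly s k0)^`().[F k0] != 0.
  rewrite hs (deriv_prod_XsubC (fun i : 'I_N => eigenband A i k0) (Ordinal j_lt)).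
  apply/prodf_neq0 => i ij; rewrite subr_eq0 eq_sym; apply/eqP/simpleF => // ij'.
  by case/eqP: ij; apply: val_inj.
have [ex3 ex4] := band_local_expansion rootF contF simple sigma_neq0 extr.
pose G p := sigma * (F p - F k0).
apply: (@constrained_minimum R n G k0 (possqrt H) q).
- move=> p; have h : F x @[x --> p] --> F p := @contF p.
  have h2 : (F x - F k0) @[x --> p] --> F p - F k0 by apply: cvgB h _; exact: cvg_cst.
  exact: (cvgMl_tmp h2).
- exact: extr.
- by move=> p; rewrite /G eigenband_even.
- by move=> p m; rewrite /G perF.
- move=> p tp /eqP; rewrite mulf_eq0 (negPf sigma_neq0) subr_eq0 => /eqP Fp.
  case: (uniqueF tp Fp) => [->|[m hm]].
    by exists 0; left; rewrite /toR map_mx0 scaler0 addr0.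
  by exists m; right.
- exact: posS.
- by case: hq => [->|[-> _]].
- have oF : ord q (fun x => F (k0 + x) - F k0 - 2^-1 * (x *m Hess F k0 *m x^T) 0 0).
    case: hq => [->//|[-> hk]]; apply: ex4 => z _.
    (* All components of [k0] are [0] or [pi], so every phase is an integer multiple of [pi] and its
       sine vanishes. *)
    have [m ->] : exists m : int, dotp (toR R z.2) k0 = m%:~R * pi; last exact: sin_int_pi.
    pose c i : int := if k0 0 i == 0 then 0 else 1.
    exists (\sum_i z.2 0 i * c i); rewrite rmorph_sum mulr_suml; apply: eq_bigr => i _.
    rewrite mxE rmorphM -mulrA; congr (_ * _); rewrite /c.
    by have [->|-> ] := hk i; rewrite ?eqxx ?mul0r // gt_eqF ?pi_gt0 // mul1r.
  apply: (@ord_eq _ _ _ (fun x => sigma *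
    (F (k0 + x) - F k0 - 2^-1 * (x *m Hess F k0 *m x^T) 0 0))); last exact: ordZ.
  (* With [S] symmetric and [S S = H], the square of [enorm (x *m S)] is the form of [H] at [x]. *)
  move=> x; rewrite /G mulrBr; congr (_ - _); rewrite mulrCA; congr (_ * _).
  rewrite sqr_enorm dotpE trmx_mul (proj1 posS).
  have e (S : 'M[R]_n) : x *m S *m (S *m x^T) = x *m (S *m S) *m x^T.
    by rewrite !mulmxA.
  rewrite e SE.
  by rewrite -scalemxAr -scalemxAl [RHS]mxE.
Qed.

End FamilyAsymptotics.

(** * Fiber operators of periodic graphs *)

(** The vertex sets of two graphs are enumerated independently and their cardinals agree only
    propositionally, so fiber matrices are compared through a bijection of indices. *)
Lemma char_poly_reindex (F : fieldType) (m n : nat) (f : 'I_m -> 'I_n)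
    (A : 'M[F]_m) (B : 'M[F]_n) : bijective f ->
  (forall i j, A i j = B (f i) (f j)) -> char_poly A = char_poly B.
Proof.
move=> bf hAB; have mn : m = n by have := bij_eq_card bf; rewrite !card_ord.
case: n / mn f B bf hAB => f B bf hAB.
pose s := perm (bij_inj bf).
have -> : A = invmx (perm_mx s^-1) *m B *m perm_mx s^-1.
  have -> : invmx (perm_mx s^-1) = perm_mx s :> 'M[F]_m.
    by rewrite -[perm_mx s]mul1mx -(@mulVmx F m (perm_mx s^-1)) ?unitmx_perm // -mulmxA
       -perm_mxM mulVg perm_mx1 mulmx1.
  rewrite -row_permE -col_permE; apply/matrixP => i j.
  by rewrite !mxE !permE.
by rewrite char_poly_conj // unitmx_perm.
Qed.

Section GraphFacts.
Local Open Scope sesquilinear_scope.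
Local Open Scope complex_scope.
Variables (R : realType) (d : nat) (G : lattice_graph R d).
Hypothesis hG : invariant_graph G.
Implicit Types (v : vertex G) (e : edge G) (m : 'rV[int]_d).

Lemma tgt_eshift m e : tgt (eshift m e) = vshift m (tgt e).
Proof. by rewrite -!(src_inv hG) (inv_eshift hG) (src_eshift hG). Qed.

Lemma tgt_inv e : tgt (Defs.inv e) = src e.
Proof. by rewrite -(src_inv hG) (Defs.invK hG). Qed.

Lemma lattice_part_vshift m v : lattice_part (vshift m v) = m + lattice_part v.
Proof.
apply/rowP => i; rewrite /lattice_part (pos_vshift hG) mulmxDl.
rewrite mulmxK ?(basis_unit hG) // !mxE addrC.
by rewrite floorDzr ?intr_int // intrKfloor.
Qed.

Lemma lattice_part_cell v : cell_vertices v -> lattice_part v = 0.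
Proof.
move=> [c c01 hc]; apply/rowP => i; rewrite /lattice_part hc mulmxK ?(basis_unit hG) //.
by rewrite !mxE; apply: floor_def; rewrite add0r; exact: c01.
Qed.

Lemma cell_part_vshift m v : cell_part (vshift m v) = cell_part v.
Proof.
rewrite /cell_part lattice_part_vshift -(vshiftD hG); congr vshift.
by rewrite opprD addrAC addNr add0r.
Qed.

Lemma cell_part_cell v : cell_vertices v -> cell_part v = v.
Proof. by move=> /lattice_part_cell h; rewrite /cell_part h oppr0 (vshift0 hG). Qed.

Lemma cell_vertexP (x : 'I_(nu G)) : cell_vertices (cell_vertex x).
Proof.
have := fsvalP (enum_val x).
by rewrite in_fset_set ?inE //; exact: finite_vertices hG.
Qed.

Lemma cell_vertex_inj : injective (@cell_vertex _ _ G).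
Proof. by move=> x y /val_inj/enum_val_inj. Qed.

Lemma cell_vertex_surj v : cell_vertices v -> exists x, @cell_vertex _ _ G x = v.
Proof.
move=> hv; have vin : v \in fset_set (@cell_vertices _ _ G).
  by rewrite in_fset_set ?inE //; exact: finite_vertices hG.
by exists (enum_rank [` vin]%fset); rewrite /cell_vertex enum_rankK.
Qed.

Lemma fiber_entry_trig (Q : vertex G -> R) x y : exists s, forall k,
  fiber_schrodinger Q k x y = trig_sum s k.
Proof.
have fin := locally_finite hG (cell_vertex x).
pose D : R := (cell_vertex x == cell_vertex y)%:R.
pose B e : R := (cell_part (tgt e) == cell_vertex y)%:R.
exists (flatten [seq [:: (D, 0); (- B e, edge_index e)] |
    e <- fset_set [set e : edge G | src e = cell_vertex x]] ++
  [:: (Q (cell_vertex x) *+ (x == y), 0)]) => k.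
rewrite /trig_sum big_cat big_flatten big_map /= big_seq1 /= /toR map_mx0 dotp0l.
rewrite expi0 mulr1 !mxE fsbig_finite //=; congr (_ + _); last by rewrite rmorphMn.
apply: eq_bigr => e _; rewrite big_cons big_seq1 /= map_mx0 dotp0l expi0 mulr1.
by rewrite rmorphN !rmorph_nat mulNr mulrC.
Qed.

Definition arcs (x y : 'I_(nu G)) : set (edge G) :=
  [set e | src e = cell_vertex x /\ cell_part (tgt e) = cell_vertex y].

(** Isolates the phases: the degree term is diagonal and real, so Hermitian symmetry comes down to
    [arcs_sum_conj]. *)
Lemma fiber_laplacianE k x y : fiber_laplacian G k x y =
  (x == y)%:R * \sum_(e \in [set e : edge G | src e = cell_vertex x]) (1 : R[i])
  - \sum_(e \in arcs x y) expi (dotp (toR R (edge_index e)) k).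
Proof.
have fin := locally_finite hG (cell_vertex x).
have fin2 : finite_set (arcs x y) by apply: sub_finite_set fin => e [].
rewrite mxE !fsbig_finite //= sumrB mulr_sumr; congr (_ - _).
  by apply: eq_bigr => e _; rewrite mulr1 (inj_eq cell_vertex_inj).
have -> : fset_set (arcs x y) = [fset e in fset_set [set e : edge G | src e = cell_vertex x]
     | cell_part (tgt e) == cell_vertex y]%fset.
  apply/fsetP => e; rewrite in_fset_set // !inE /= in_fset_set //.
  apply/idP/andP => [/set_mem[h1 h2]|[/set_mem h1 /eqP h2]]; last exact/mem_set.
  by split; [exact/mem_set|exact/eqP].
rewrite -big_fset_condE /= [RHS]big_mkcond; apply: eq_bigr => e _.
by case: eqP; rewrite ?mulr1 ?mulr0.
Qed.

Lemma arcs_finite x y : finite_set (arcs x y).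
Proof. by apply: sub_finite_set (locally_finite hG (cell_vertex x)) => e []. Qed.

(* The inverse of [e], translated so that its source lies in the cell. *)
Definition reverse_arc e : edge G := eshift (- lattice_part (tgt e)) (Defs.inv e).

Lemma reverse_arcK x y e : e \in arcs x y -> reverse_arc (reverse_arc e) = e.
Proof.
rewrite inE => -[se te]; rewrite /reverse_arc (inv_eshift hG) (Defs.invK hG).
rewrite tgt_eshift tgt_inv se lattice_part_vshift (lattice_part_cell (cell_vertexP x)).
by rewrite addr0 opprK -(eshiftD hG) addrN (eshift0 hG).
Qed.

Lemma reverse_arc_arcs x y e : arcs x y e -> arcs y x (reverse_arc e).
Proof.
move=> [se te]; split; rewrite /reverse_arc.
  by rewrite (src_eshift hG) (src_inv hG) -te.
rewrite tgt_eshift tgt_inv se cell_part_vshift cell_part_cell //.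
exact: cell_vertexP.
Qed.

Lemma edge_index_reverse x y e : arcs x y e -> edge_index (reverse_arc e) = - edge_index e.
Proof.
move=> [se te]; rewrite /edge_index /reverse_arc (src_eshift hG) (src_inv hG).
rewrite tgt_eshift tgt_inv !lattice_part_vshift addNr se.
by rewrite (lattice_part_cell (cell_vertexP x)) ?(subr0, addr0).
Qed.

(** Reversing arcs is a bijection that negates the index, hence conjugates the phase. *)
Lemma arcs_sum_conj x y k :
  (\sum_(e \in arcs y x) expi (dotp (toR R (edge_index e)) k))^*%C =
  \sum_(e \in arcs x y) expi (dotp (toR R (edge_index e)) k).
Proof.
rewrite (@reindex_fsbig _ _ _ _ _ reverse_arc (arcs y x) (arcs x y)); last first.
  split.
  - by move=> e; exact: reverse_arc_arcs.
  - by move=> e f he hf ef; rewrite -(reverse_arcK he) ef (reverse_arcK hf).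
  - move=> e he; exists (reverse_arc e); first exact: reverse_arc_arcs.
    by rewrite (@reverse_arcK x y) // inE.
rewrite !fsbig_finite; try exact: arcs_finite.
rewrite rmorph_sum; apply: eq_big_seq => e.
rewrite in_fset_set ?inE => [he|]; last exact: arcs_finite.
by rewrite (edge_index_reverse he) /toR map_mxN dotpNl expiN.
Qed.

Lemma fiber_hermitian (Q : vertex G -> R) k :
  (fiber_schrodinger Q k)^t* = fiber_schrodinger Q k.
Proof.
have E x y : fiber_schrodinger Q k x y = fiber_laplacian G k x y +
    (Q (cell_vertex x))%:C *+ (x == y) by rewrite mxE; congr (_ + _); rewrite !mxE.
apply/matrixP => x y; rewrite mxE [X in Num.conj X]mxE !E !fiber_laplacianE //.
rewrite -[LHS]/(conjc _) !rmorphD rmorphN; congr (_ - _ + _).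
- rewrite eq_sym; case: eqP => [->|_]; last by rewrite !mul0r rmorph0.
  rewrite !mul1r !fsbig_finite; try exact: (locally_finite hG).
  by rewrite rmorph_sum; apply: eq_bigr => e _; rewrite rmorph1.
- exact: arcs_sum_conj.
- rewrite eq_sym; case: eqP => [->|_]; rewrite ?mulr1n ?mulr0n ?rmorph0 //.
  exact: conjc_real.
Qed.

End GraphFacts.

(** * The perturbed graph as a restriction of the limit graph *)

Section Limit.
Variables (R : realType) (d : nat) (G : lattice_graph R d) (v1 v2 : vertex G).
Variables (t : 'rV[int]_d) (a : 'rV[R]_(d + 1)) (Q : vertex G -> R).
Hypothesis hG : invariant_graph G.
Hypothesis a_basis : limit_basis G a \in unitmx.
Hypothesis v1_cell : cell_vertices v1.
Hypothesis v2_cell : cell_vertices v2.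
Local Notation Gt := (perturbed_graph v1 v2 t).
Local Notation L := (limit_graph v1 v2 a).

Lemma limit_pos (v : vertex G) (m : int) : @pos _ _ L (v, m) =
  row_mx (pos v *m invmx (Defs.basis G)) (m%:~R)%:M *m limit_basis G a.
Proof. exact: (@stack_pos _ _ G a (v, m) hG). Qed.

Lemma limit_lattice_part (v : vertex G) (m : int) :
  @lattice_part _ _ L (v, m) = row_mx (lattice_part v) m%:M.
Proof.
rewrite /lattice_part limit_pos [Defs.basis L]/(limit_basis G a) mulmxK //= map_row_mx.
congr row_mx.
by apply/matrixP => i j; rewrite !ord1 !mxE eqxx !mulr1n intrKfloor.
Qed.

Lemma limit_cell_part (v : vertex G) (m : int) :
  @cell_part _ _ L (v, m) = (cell_part v, 0).
Proof.
rewrite /cell_part limit_lattice_part /= opp_row_mx row_mxKl row_mxKr.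
by rewrite !mxE eqxx mulr1n addNr.
Qed.

Lemma limit_cell_vertices (v : vertex G) (m : int) :
  @cell_vertices _ _ L (v, m) <-> cell_vertices v /\ m = 0.
Proof.
split.
  move=> [c c01 hc].
  move: hc; rewrite limit_pos -[c]hsubmxK => /(congr1 (mulmxr (invmx (limit_basis G a)))) /=.
  rewrite !mulmxK // => /eq_row_mx[h1 h2].
  split; last first.
    have /matrixP/(_ 0 0) := h2; rewrite !mxE eqxx mulr1n => h.
    have := c01 (rshift d 0); rewrite -h ler0z ltrz1.
    by case: (m) => [[|k]|k].
  exists (lsubmx c); first by move=> i; rewrite mxE.
  by rewrite -h1 mulmxKV ?(basis_unit hG).
move=> [[c c01 hc] m0]; exists (row_mx c 0).
  move=> i; rewrite mxE; case: splitP => k _; first exact: c01.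
  by rewrite mxE lexx ltr01.
rewrite limit_pos m0 hc mulmxK ?(basis_unit hG) //.
by congr (row_mx _ _ *m _); apply/matrixP => i j; rewrite !mxE mul0rn.
Qed.

(** Sources must land in layer 0. The inverse of the new edge starts at [v2 + t + m] in the
    perturbed graph but in layer 1 of the limit graph, which explains the shift by [m + t] and the
    [-1]. *)
Definition lift_edge (e : edge Gt) : edge L :=
  match e with
  | inl e => inl (e, 0)
  | inr (m, false) => inr (row_mx m 0, false)
  | inr (m, true) => inr (row_mx (m + t) (const_mx (-1)), true)
  end.

Lemma src_lift_edge e : src (lift_edge e) = (src e, 0).
Proof.
case: e => [e|[m []]] //=; rewrite row_mxKl row_mxKr !mxE ?addNr ?addr0 //.
by rewrite (vshiftD hG).
Qed.

(* The targets of [e] and of [lift_edge e] agree only up to a translation. *)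
Lemma cell_part_tgt_lift_edge e :
  cell_part (tgt (lift_edge e)) = (@cell_part _ _ Gt (tgt e), 0).
Proof.
have tE : exists u, exists m, tgt (lift_edge e) = (vshift u (tgt e), m).
  case: e => [e|[m []]] /=; first by exists 0, 0; rewrite (vshift0 hG).
  - by exists t, (-1 + 0); rewrite row_mxKl row_mxKr mxE (addrC m) (vshiftD hG).
  - exists (- t), (0 + 1); rewrite row_mxKl row_mxKr mxE -!(vshiftD hG).
    by rewrite addrAC addNr [0 + m]add0r.
have [u [m ->]] := tE; rewrite limit_cell_part; congr pair.
exact: cell_part_vshift.
Qed.

(** A limit index [(u, m)] paired with [(k, <t, k>)] gives [<u + m t, k>]: one step up in the limit
    graph counts as a translation by [t]. *)
Lemma lift_edge_phase e k :
  dotp (toR R (edge_index (lift_edge e))) (row_mx k (dotp (toR R t) k)%:M) =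
  dotp (toR R (@edge_index _ _ Gt e)) k.
Proof.
have P (u : 'rV[int]_d) (m : int) :
    dotp (toR R (row_mx u m%:M)) (row_mx k (dotp (toR R t) k)%:M) =
    dotp (toR R u + m%:~R *: toR R t) k.
  rewrite /toR map_row_mx dotp_row_mx dotpDl; congr (_ + _).
  by rewrite {1}/dotp big_ord1 !mxE eqxx !mulr1n [RHS]dotpC dotpZr dotpC.
have I : edge_index (lift_edge e) =
    lattice_part (tgt (lift_edge e)) - lattice_part (src (lift_edge e)) by [].
have v1E := lattice_part_cell hG v1_cell; have v2E := lattice_part_cell hG v2_cell.
rewrite I src_lift_edge limit_lattice_part.
case: e {I} => [e|[m []]] /=.
- rewrite limit_lattice_part opp_row_mx add_row_mx subrr.
  have -> : 0 = (0 : int)%:M :> 'M[int]_1 by apply/matrixP => i j; rewrite !mxE mul0rn.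
  by rewrite P scale0r addr0.
- rewrite row_mxKl row_mxKr mxE limit_lattice_part opp_row_mx add_row_mx.
  rewrite !(lattice_part_vshift hG) v1E v2E !addr0 subrr -raddfB subr0 P.
  rewrite rmorphN1 scaleN1r /toR map_mx0 add0r /edge_index /=.
  rewrite [@lattice_part _ _ Gt _](lattice_part_vshift hG).
  rewrite [X in _ - X](lattice_part_vshift hG) [X in _ - (_ + X)](lattice_part_vshift hG).
  by rewrite v1E v2E !addr0 opprD addrA subrr add0r map_mxN.
- rewrite row_mxKl row_mxKr mxE limit_lattice_part opp_row_mx add_row_mx.
  rewrite !(lattice_part_vshift hG) v1E v2E !addr0 subrr -raddfB subr0 add0r P.
  rewrite rmorph1 scale1r /toR map_mx0 add0r /edge_index /=.
  rewrite [X in X - _](lattice_part_vshift hG) [X in _ + X - _](lattice_part_vshift hG).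
  rewrite [X in _ - X](lattice_part_vshift hG).
  by rewrite v1E v2E !addr0 addrAC subrr add0r.
Qed.

Lemma lift_edge_bij (v : vertex G) :
  set_bij [set e : edge Gt | src e = v] [set f : edge L | src f = (v, 0)] lift_edge.
Proof.
split.
- by move=> e he; have := src_lift_edge e; rewrite (he : src e = v).
- move=> e f _ _; case: e => [e|[m []]]; case: f => [f|[m' []]] //=.
  + by move=> [->].
  + by move=> [] /eq_row_mx[/addIr -> _].
  + by move=> [] /eq_row_mx[-> _].
- move=> [[e m]|[m []]] /=.
  + by move=> [he m0]; exists (inl e) => //=; rewrite m0.
  + move=> [he m0]; exists (inr (lsubmx m - t, true)) => /=.
      by rewrite -(vshiftD hG) subrK.
    rewrite subrK -[in RHS](hsubmxK m); congr (inr (row_mx _ _, _)).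
    apply/matrixP => i j; rewrite !ord1 [LHS]mxE; apply/esym/eqP.
    by rewrite -addr_eq0; apply/eqP; rewrite -[RHS]m0; congr (_ + _); congr (rsubmx _ _ _).
  + move=> [he m0]; exists (inr (lsubmx m, false)) => //=.
    rewrite -[in RHS](hsubmxK m); congr (inr (row_mx _ _, _)).
    by apply/matrixP => i j; rewrite !ord1 [LHS]mxE -[LHS]m0 addr0.
Qed.

(** A cell vertex of the limit graph has its last coordinate both integral and in [[0, 1)], hence
    lies in layer 0. *)
Lemma limit_index : exists2 f : 'I_(nu Gt) -> 'I_(nu L),
  bijective f & forall x, cell_vertex (f x) = (cell_vertex x, 0).
Proof.
have hL : invariant_graph L by apply: add_edges_invariant; exact: stack_invariant.
have hT : invariant_graph Gt by exact: add_edges_invariant.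
have exf (x : 'I_(nu Gt)) : exists y : 'I_(nu L), cell_vertex y = (cell_vertex x, 0).
  apply: (cell_vertex_surj hL); apply/limit_cell_vertices; split => //.
  exact: (cell_vertexP hT x).
have [f hf] := choice exf; exists f => //.
have injf : injective f.
  move=> x y /(congr1 (@cell_vertex _ _ L)); rewrite !hf => -[h].
  exact: (@cell_vertex_inj _ _ Gt).
have exg (y : 'I_(nu L)) : exists x : 'I_(nu Gt), f x = y.
  have := cell_vertexP hL y; case E : (cell_vertex y) => [v m].
  move=> /limit_cell_vertices[hv m0].
  have [x hx] := @cell_vertex_surj _ _ Gt hT v hv.
  exists x; apply: (@cell_vertex_inj _ _ L); rewrite hf E m0.
  by rewrite hx.
have [g hg] := choice exg.
by exists g => [x|y]; [apply: injf; rewrite hg|rewrite hg].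
Qed.

Lemma fiber_perturbed k (f : 'I_(nu Gt) -> 'I_(nu L)) :
  (forall x, cell_vertex (f x) = (cell_vertex x, 0)) ->
  forall x y, @fiber_schrodinger _ _ Gt Q k x y =
   @fiber_schrodinger _ _ L (limit_potential Q) (row_mx k (dotp (toR R t) k)%:M) (f x) (f y).
Proof.
move=> hf x y.
have hT : invariant_graph Gt by exact: add_edges_invariant.
have injf : injective f.
  move=> u v /(congr1 (@cell_vertex _ _ L)); rewrite !hf => -[h].
  exact: (@cell_vertex_inj _ _ Gt).
have pairE (u v : vertex G) : ((u, 0 : int) == (v, 0)) = (u == v).
  by rewrite xpair_eqE eqxx andbT.
rewrite /fiber_schrodinger mxE [RHS]mxE; congr (_ + _); last first.
  by rewrite !mxE hf (inj_eq injf).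
rewrite /fiber_laplacian mxE [RHS]mxE hf.
rewrite (reindex_fsbig lift_edge _ _ _ (lift_edge_bij (cell_vertex x))).
rewrite !fsbig_finite; try exact: (locally_finite hT).
apply: eq_bigr => e _; rewrite lift_edge_phase cell_part_tgt_lift_edge !hf.
by rewrite !pairE.
Qed.

(** [perturbed_graph] keeps the vertices and the basis of [G], so its [nu] is that of [G] by
    conversion, whatever [t]. *)
Lemma nu_limit : nu L = nu G.
Proof.
have [f bf _] := limit_index; have := bij_eq_card bf.
by rewrite !card_ord => <-.
Qed.

Lemma band_perturbed j k : @band _ _ Gt Q j k =
  @band _ _ L (limit_potential Q) j (row_mx k (dotp (toR R t) k)%:M).
Proof.
have [f bf hf] := limit_index.
rewrite /band /sorted_eigenvalues.
by rewrite (char_poly_reindex bf (fiber_perturbed k hf)).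
Qed.

End Limit.

(** * Asymptotics of the band edges *)

Section BandEdge.
Variables (R : realType) (d : nat) (G : lattice_graph R d) (Q : vertex G -> R).

(** A uniform bound controls the infimum or supremum on one side and a single test point on the
    other, so approximate minimizers suffice. *)
Lemma band_edge_bounds (s : edge_side) (j : nat) (c B1 B2 : R) (k : 'rV[R]_d) :
  (forall k', torus k' -> B1 <= - side_sign R s * (band Q j k' - c)) ->
  torus k -> - side_sign R s * (band Q j k - c) <= B2 ->
  B1 <= - side_sign R s * (band_edge Q s j - c) <= B2.
Proof.
move=> hB1 tk hB2; set E := [set band Q j k | k in @torus R d].
have Ek : E (band Q j k) by exists k.
case: s hB1 hB2 => /= hB1 hB2.
- have lbE : lbound E (B1 + c) 
    by move=> _ [k' tk' <-]; have := hB1 k' tk'; move: (band Q j k') => z; lra.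
  have h1 : B1 + c <= inf E by apply: lb_le_inf => //; exists (band Q j k).
  have h2 : inf E <= band Q j k by apply: ge_inf => //; exists (B1 + c).
  by move: (inf E) (band Q j k) h1 h2 hB2 => e b h1 h2 hB2; apply/andP; split; lra.
- have ubE : ubound E (c - B1) 
    by move=> _ [k' tk' <-]; have := hB1 k' tk'; move: (band Q j k') => z; lra.
  have h1 : sup E <= c - B1 by apply: ge_sup => //; exists (band Q j k).
  have h2 : band Q j k <= sup E by apply: ub_le_sup => //; exists (c - B1).
  by move: (sup E) (band Q j k) h1 h2 hB2 => e b h1 h2 hB2; apply/andP; split; lra.
Qed.

Lemma extremum_point_ge0 (s : edge_side) (f : 'rV[R]_d -> R) (k k' : 'rV[R]_d) :
  extremum_point s f k -> torus k' -> 0 <= - side_sign R s * (f k' - f k).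
Proof. by case: s => -[_ h] /h /=; lra. Qed.

Lemma band_edge_attained (s : edge_side) (j : nat) (k : 'rV[R]_d) :
  extremum_point s (band Q j) k -> band_edge Q s j = band Q j k.
Proof.
move=> hk; have tk : torus k by case: hk.
have : 0 <= - side_sign R s * (band_edge Q s j - band Q j k) <= 0.
  apply: (band_edge_bounds (k := k)) => //; last by rewrite subrr mulr0.
  by move=> k'; exact: extremum_point_ge0.
move: (band_edge Q s j) (band Q j k) => x y.
by case: (s) => /= /andP[h1 h2]; apply/eqP; rewrite eq_le; apply/andP; split; lra.
Qed.

End BandEdge.

Theorem theorem2p6 (R : realType) (d : nat) (G : lattice_graph R d)
  (G_periodic : periodic_graph G)
  (v1 v2 : vertex G) (v1_cell : cell_vertices v1) (v2_cell : cell_vertices v2)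
  (Q : vertex G -> R) (Q_periodic : periodic_potential Q)
  (a : 'rV[R]_(d + 1)) (a_basis : limit_basis G a \in unitmx)
  (j : nat) (j_lt : (j < nu G)%N) (s : edge_side) (k0 : 'rV[R]_(d + 1)) :
  let Glim := limit_graph v1 v2 a in
  let Qlim := @limit_potential R d G v1 v2 a Q in
  let lambda_lim := @band R (d + 1) Glim Qlim in
  let edge_lim := @band_edge R (d + 1) Glim Qlim s j in
  let H := - side_sign R s *: Hess (lambda_lim j) k0 in
  extremum_point s (lambda_lim j) k0 ->
  posdef H ->
  (forall i k, (i < nu Glim)%N -> i <> j -> torus k ->
     lambda_lim i k <> edge_lim) ->
  (forall k, extremum_point s (lambda_lim j) k ->
     k = k0 \/ exists n : 'rV[int]_(d + 1), k = - k0 + (2 * pi) *: toR R n) ->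
  exists g : 'rV[int]_d -> R,
    [/\ forall t : 'rV[int]_d,
          @band_edge R d (perturbed_graph v1 v2 t) Q s j =
          edge_lim
          - side_sign R s *
            (2 * pi ^+ 2 * alpha (rho t k0) ^+ 2 /
             enorm (invmx (possqrt H) *m
                    (row_mx (toR R t) (const_mx (-1)))^T)^T ^+ 2)
          + g t,
        bigO_inv_power 3 g
      & (forall i, k0 0 i = 0 \/ k0 0 i = pi) ->
        bigO_inv_power 4 g ].
Proof.
move=> Glim Qlim lambda_lim edge_lim H ext0 posH simple uniq.
have [hG _ _] := G_periodic.
have hL : invariant_graph Glim by apply: add_edges_invariant; exact: stack_invariant.
have edgeE : edge_lim = lambda_lim j k0 by exact: band_edge_attained.
have j_lt' : (j < nu Glim)%N by rewrite (nu_limit v1 v2 0 hG a_basis).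
pose A := @fiber_schrodinger _ _ Glim Qlim; pose sigma := - side_sign R s.
have sigma2 : sigma * side_sign R s = -1.
  by rewrite /sigma; case: (s); rewrite /= ?mulr1 ?mulrN1 ?opprK.
have sigma0 : sigma != 0 by apply: contra_eq_neq sigma2 => ->; rewrite mul0r; lra.
have sigma1 : `|sigma| = 1 by rewrite /sigma; case: (s); rewrite /= ?opprK ?normrN normr1.
have trigA x y : exists s, forall k, A k x y = trig_sum s k by exact: fiber_entry_trig.
have hermA k := fiber_hermitian hL Qlim k.
have extrF k : torus k -> 0 <= sigma * (eigenband A j k - eigenband A j k0).
  exact: extremum_point_ge0.
have simpleF i : (i < nu Glim)%N -> i <> j -> eigenband A i k0 <> eigenband A j k0.
  move=> iN ij; rewrite -[eigenband A j k0]/(lambda_lim j k0) -edgeE.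
  by apply: simple => //; exact: ext0.1.
have uniqueF k : torus k -> eigenband A j k = eigenband A j k0 ->
    k = k0 \/ exists m : 'rV[int]_(d + 1), k = - k0 + (2 * pi) *: toR R m.
  (* A point sharing the value at [k0] is itself an extremum point. *)
  move=> tk Fk; apply: uniq; split; first exact: tk.
  move=> k' tk'.
  by rewrite [lambda_lim j k]Fk; apply: ext0.2.
have key := family_constrained_minimum trigA hermA j_lt' sigma0 posH extrF simpleF uniqueF.
pose S := possqrt H.
have Ssym : S^T = S by have [[]] := possqrtP posH.
pose tt (t : 'rV[int]_d) : 'rV[int]_(d + 1) := row_mx t (const_mx (-1)).
have ttE t : toR R (tt t) = row_mx (toR R t) (const_mx (-1)).
  by rewrite /toR map_row_mx map_const_mx rmorphN1.
have tt_dotp t p : dotp (toR R (tt t)) p = dotp (toR R t) (lsubmx p) - rsubmx p 0 0.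
  rewrite ttE -{1}[p]hsubmxK dotp_row_mx; congr (_ + _).
  by rewrite /dotp big_ord1 mxE mulN1r.
have rhoE t : rho t k0 = dotp (toR R (tt t)) k0 / (2 * pi).
  by rewrite tt_dotp mulrC.
have denE t : (invmx S *m (row_mx (toR R t) (const_mx (-1)))^T)^T = toR R (tt t) *m invmx S.
  by rewrite trmx_mul trmxK trmx_inv Ssym ttE.
pose E t := 2 * pi ^+ 2 * alpha (rho t k0) ^+ 2 / enorm (toR R (tt t) *m invmx S) ^+ 2.
pose b t := @band_edge R d (perturbed_graph v1 v2 t) Q s j.
pose g t := b t - (edge_lim - side_sign R s * E t).
have gE t : g t = side_sign R s * (E t - sigma * (b t - edge_lim)).
  by rewrite [RHS]mulrBr [X in _ - X]mulrA [side_sign R s * sigma]mulrC sigma2 /g; ring.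
have enorm_tt t : enorm (toR R t) <= enorm (toR R (tt t)).
  by rewrite ttE /enorm dotp_row_mx ler_wsqrtr // lerDl dotp_ge0.
have gO q : q = 3 \/ (q = 4 /\ forall i, k0 0 i = 0 \/ k0 0 i = pi) -> bigO_inv_power q g.
  move=> hq; have [C [M [C0 hC]]] := key q hq.
  (* The 1 keeps [enorm (toR R t)] positive, so that its inverse powers can be compared with those
     of the larger [enorm (toR R (tt t))]. *)
  exists C, (Num.max 1 M) => t; rewrite ge_max => /andP[t1 tM].
  have [[p [N [dp Gp]]] lowG] := hC (tt t) (le_trans tM (enorm_tt t)).
  rewrite -rhoE -/(E t) in Gp lowG.
  have sg1 : `|side_sign R s| = 1 by rewrite -normrN.
  rewrite gE normrM sg1 mul1r.
  apply: (@le_trans _ _ (C / enorm (toR R (tt t)) ^+ q)); last first.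
    rewrite ler_wpM2l // lef_pV2 ?posrE ?exprn_gt0 ?(lt_le_trans _ t1)
      ?(lt_le_trans _ (enorm_tt t)) //.
      by rewrite lerXn2r ?nnegrE ?enorm_ge0.
    by rewrite (lt_le_trans _ t1).
  rewrite ler_distlC.
  have bandE := band_perturbed t Q hG a_basis v1_cell v2_cell j.
  have [m tm] := torus_shift (lsubmx p).
  apply: (@band_edge_bounds _ _ (perturbed_graph v1 v2 t) Q s j edge_lim _ _
    (lsubmx p + (2 * pi) *: toR R m)) => //.
    (* The point [(k, <t, k>)] meets the constraint with integer 0. *)
    move=> k _; rewrite bandE edgeE; apply: (lowG _ 0).
    by rewrite tt_dotp row_mxKl row_mxKr mxE eqxx mulr1n subrr mulr0.
  rewrite bandE edgeE; move: Gp.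
  (* Once [m] has moved the first [d] components of [p] into the torus, this is the shift of the
     last one that puts the point on the graph of [k -> <t, k>]. *)
  rewrite -(eigenband_periodic trigA j p (row_mx m (N + \sum_i t 0 i * m 0 i)%:M)).
  rewrite (_ : p + _ = row_mx (lsubmx p + (2 * pi) *: toR R m)
    (dotp (toR R t) (lsubmx p + (2 * pi) *: toR R m))%:M); first exact.
  rewrite -{1}[p]hsubmxK /toR map_row_mx scale_row_mx add_row_mx; congr row_mx.
  apply/matrixP => x y; rewrite !ord1 [RHS]mxE eqxx mulr1n dotpDr dotpZr dotp_toR.
  move: dp; rewrite tt_dotp => /(canRL (subrK _)) ->.
  by rewrite !mxE eqxx mulr1n rmorphD /=; move: (pi : R) => P; ring.
exists g; split.
- by move=> t; rewrite denE -/(E t) /g addrC subrK.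
- by apply: gO; left.
- by move=> hk; apply: gO; right.
Qed.
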